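(* There is a quasi-Banach space $Y$ such that the topology of $Y$ is not the supremum of two (not necessarily Hausdorff) vector topologies $\tau_1$ and $\tau_2$ on $Y$ such that $(Y,\tau_1)$ is nearly convex and $(Y,\tau_2)$ has trivial dual.
   Context: For a vector topology $\tau$, not necessarily Hausdorff, on a vector space $Y$: $(Y,\tau)$ is nearly convex if its Hausdorff quotient (the quotient by the $\tau$-closure of $\{0\}$) has a separating dual, i.e. its continuous linear functionals separate its points; $(Y,\tau)$ has trivial dual if the only $\tau$-continuous linear functional on $Y$ is $0$. *)

(* Defs.v *)
From HB Require Import structures.
From mathcomp Require Import all_boot all_order all_algebra.
From mathcomp Require Import generic_quotient ring_quotient.
From mathcomp Require Import all_classical all_reals all_analysis.

Set Implicit Arguments.
Unset Strict Implicit.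
Unset Printing Implicit Defensive.

Import Order.TTheory GRing.Theory Num.Theory.
Import numFieldNormedType.Exports.

Local Open Scope classical_set_scope.
Local Open Scope ring_scope.

Section HausdorffQuotient.
Context {K : numFieldType}.
Local Open Scope quotient_scope.

Definition zero_closure (V : topologicalLmodType K) : V -> bool :=
  fun x => x \in closure [set (0 : V)].

Lemma zero_closureP (V : topologicalLmodType K) (x : V) :
  zero_closure x <-> forall B, nbhs x B -> B 0.
Proof.
rewrite /zero_closure inE; split.
  by move=> h B /h [_ [-> ]].
by move=> h B /h B0; exists 0.
Qed.

Lemma zero_closure_zmod_closed (V : topologicalLmodType K) :
  zmod_closed (@zero_closure V).
Proof.
split; first by apply/zero_closureP => B /nbhs_singleton.
move=> x y /zero_closureP hx /zero_closureP hy; apply/zero_closureP => B Bxy.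
have [[A1 A2] [/= /hx A10 /hy A20] A12B] := @sub_continuous V (x, y) B Bxy.
by move: (A12B (0, 0)) => /=; rewrite subr0; apply.
Qed.

HB.instance Definition _ (V : topologicalLmodType K) :=
  GRing.isZmodClosed.Build V (@zero_closure V) (@zero_closure_zmod_closed V).

Lemma zero_closureZ (V : topologicalLmodType K) (a : K) (x : V) :
  zero_closure x -> zero_closure (a *: x).
Proof.
move=> /zero_closureP hx; apply/zero_closureP => B Bax.
have [[A1 A2] [/= /nbhs_singleton A1a /hx A20] A12B] :=
  @scale_continuous K V (a, x) B Bax.
by move: (A12B (a, 0)) => /=; rewrite scaler0; apply.
Qed.

Definition hausdorff_quotient (V : topologicalLmodType K) : Type :=
  Quotient.quot (GRing.ZmodClosed.clone V (@zero_closure V) _).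

Section Instances.
Variable V : topologicalLmodType K.
Local Notation Q := (hausdorff_quotient V).

HB.instance Definition _ := GRing.Zmodule.on Q.
HB.instance Definition _ := ZmodQuotient.on Q.

Definition hq_scale (a : K) : Q -> Q := lift_op1 Q ( *:%R a).

Lemma pi_hq_scale (a : K) (x : V) : \pi_Q (a *: x) = hq_scale a (\pi_Q x).
Proof.
rewrite /hq_scale; unlock; apply/eqP; rewrite -Quotient.idealrBE -scalerBr.
by apply: zero_closureZ; rewrite [zero_closure _]Quotient.idealrBE reprK.
Qed.

Lemma hq_scaleA a b (x : Q) : hq_scale a (hq_scale b x) = hq_scale (a * b) x.
Proof. by rewrite -[x]reprK -!pi_hq_scale scalerA. Qed.

Lemma hq_scale1 : left_id 1 hq_scale.
Proof. by move=> x; rewrite -[x]reprK -pi_hq_scale scale1r. Qed.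

Lemma hq_scaleDr : right_distributive hq_scale +%R.
Proof.
move=> a x y; rewrite -[x]reprK -[y]reprK -raddfD -!pi_hq_scale -raddfD.
by rewrite scalerDr.
Qed.

Lemma hq_scaleDl (x : Q) : {morph hq_scale^~ x : a b / a + b}.
Proof. by move=> a b; rewrite -[x]reprK -!pi_hq_scale -raddfD scalerDl. Qed.

HB.instance Definition _ := GRing.Zmodule_isLmodule.Build K Q
  hq_scaleA hq_scale1 hq_scaleDr hq_scaleDl.

Definition hq_open : set_system Q := fun U => open (\pi_Q @^-1` U : set V).

Lemma hq_openT : hq_open setT.
Proof. by rewrite /hq_open preimage_setT; exact: openT. Qed.

Lemma hq_openI : setI_closed hq_open.
Proof. by move=> A B; exact: openI. Qed.

Lemma hq_open_bigU (I : Type) (f : I -> set Q) :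
  (forall i, hq_open (f i)) -> hq_open (\bigcup_i f i).
Proof. by move=> fo; apply: bigcup_open => i _; exact: fo. Qed.

HB.instance Definition _ :=
  isOpenTopological.Build Q hq_openT hq_openI hq_open_bigU.

End Instances.
End HausdorffQuotient.

Definition has_separating_dual (K : numFieldType)
    (V : preTopologicalLmodType K) : Prop :=
  forall x y : V, x <> y ->
    exists f : {linear V -> K^o}, continuous f /\ f x <> f y.

Definition nearly_convex (K : numFieldType) (V : topologicalLmodType K) : Prop :=
  has_separating_dual (hausdorff_quotient V).

Definition has_trivial_dual (K : numFieldType)
    (V : topologicalLmodType K) : Prop :=
  forall f : {linear V -> K^o}, continuous f -> forall x, f x = 0.

(* A topology as a family of open sets, so that a single vector space can be
   considered under several of them. *)
Record topology_on (T : Type) := TopologyOn {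
  opens :> set_system T;
  opensT : opens setT;
  opensI : setI_closed opens;
  opens_bigU : forall (I : Type) (f : I -> set T),
    (forall i, opens (f i)) -> opens (\bigcup_i f i) }.

Section Endow.
Context {K : numFieldType} {Y : lmodType K}.

Definition endow (tau : topology_on Y) : Type := Y.

HB.instance Definition _ (tau : topology_on Y) := GRing.Lmodule.on (endow tau).
HB.instance Definition _ (tau : topology_on Y) :=
  isOpenTopological.Build (endow tau)
    (@opensT _ tau) (@opensI _ tau) (@opens_bigU _ tau).

Record vector_topology := VectorTopology {
  vtopology :> topology_on Y;
  vtopology_add :
    continuous (fun z : endow vtopology * endow vtopology => z.1 + z.2);
  vtopology_scale :
    continuous (fun z : K^o * endow vtopology => z.1 *: z.2) }.

Definition endow_vt (tau : vector_topology) : Type := endow tau.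

HB.instance Definition _ (tau : vector_topology) :=
  PreTopologicalLmodule.on (endow_vt tau).
HB.instance Definition _ (tau : vector_topology) :=
  PreTopologicalNmodule_isTopologicalNmodule.Build (endow_vt tau)
    (@vtopology_add tau).
HB.instance Definition _ (tau : vector_topology) :=
  TopologicalNmodule_isTopologicalLmodule.Build K (endow_vt tau)
    (@vtopology_scale tau).

Definition is_supremum (tau tau1 tau2 : topology_on Y) : Prop :=
  opens tau = @open (sup_topology (fun b : bool =>
    if b then Topological.on (endow tau1) else Topological.on (endow tau2))).

End Endow.
Arguments vector_topology {K} Y.

Record quasiBanachType (R : realType) := QuasiBanachType {
  qb_sort :> lmodType R;
  qnorm : qb_sort -> R;
  qnorm_ge0 : forall x, 0 <= qnorm x;
  qnorm_eq0 : forall x, qnorm x = 0 -> x = 0;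
  qnormZ : forall (a : R) x, qnorm (a *: x) = `|a| * qnorm x;
  qnorm_quasi_triangle : exists C : R,
    forall x y, qnorm (x + y) <= C * (qnorm x + qnorm y);
  qnorm_complete : forall u : nat -> qb_sort,
    (forall e, 0 < e -> exists N, forall m n, (N <= m)%N -> (N <= n)%N ->
       qnorm (u m - u n) < e) ->
    exists l, forall e, 0 < e -> exists N, forall n, (N <= n)%N ->
       qnorm (u n - l) < e }.

Section QNormTopology.
Context {R : realType} (Y : quasiBanachType R).

(* Quasi-norm balls form a neighborhood base but need not themselves be open. *)
Definition qnorm_open : set_system Y := fun U =>
  forall x, U x -> exists2 e, 0 < e & forall y, qnorm (y - x) < e -> U y.

Lemma qnorm_openT : qnorm_open setT.
Proof. by move=> x _; exists 1. Qed.

Lemma qnorm_openI : setI_closed qnorm_open.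
Proof.
move=> A B Ao Bo x [/Ao [e1 e10 h1] /Bo [e2 e20 h2]].
exists (Num.min e1 e2); first by rewrite lt_min e10.
by move=> y; rewrite lt_min => /andP[/h1 ? /h2 ?].
Qed.

Lemma qnorm_open_bigU (I : Type) (f : I -> set Y) :
  (forall i, qnorm_open (f i)) -> qnorm_open (\bigcup_i f i).
Proof.
move=> fo x [i _ /fo [e e0 h]]; exists e => // y /h fy.
by exists i.
Qed.

Definition qnorm_topology : topology_on Y :=
  TopologyOn qnorm_openT qnorm_openI qnorm_open_bigU.

End QNormTopology.

(* Main.v *)
Require Import Defs.
From HB Require Import structures.
From mathcomp Require Import all_boot all_order all_algebra.
From mathcomp Require Import generic_quotient ring_quotient.
From mathcomp Require Import all_classical all_reals all_analysis.
From mathcomp Require Import ring lra.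

(** Let Q : l^{1/2} -> l^1 send the unit vectors to a sequence that is dense in
    the unit sphere of l^1.  It is onto, every x in l^1 has a lift of norm at
    most a constant times that of x, but no bounded linear choice of lifts exists on
    an infinite-dimensional subspace.  The space Y consists of the L^{1/2} families
    f of elements of l^{1/2}, over a non-atomic probability space, for which
    Q o f is constant; the value of that constant is the base of f, and L is the
    space of the families of base 0.  The norms are written in their subadditive
    form N (f) = E (sum_s sqrt |f_s|), whose square is the quasi-norm.

    Every element l of L is the mean of 2 l 1_A and 2 l 1_B, where A and B are
    complementary halves of the probability space, and these lie in L too.  With
    A and B chosen well both have quasi-norm half that of l, so a continuous
    functional on Y vanishes on L ([kernel_split], [functional_kernel]).  Hence,
    for a nearly convex topology tau1 coarser than that of Y, the closure of 0
    contains L, and if the topology of Y is the supremum of tau1 and tau2, then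
    small tau2-neighbourhoods of 0 meet L only in vectors of small norm.

    Let tau2 be coarser than the topology of Y and have trivial dual.  On a
    tau2-neighbourhood of 0 no coordinate of the base can be controlled by
    finitely many others, since a combination of coordinates would then be
    tau2-continuous ([common_kernel]).  So the neighbourhood contains families
    whose base lies in the unit ball of l^1, with most of its mass beyond a
    prescribed coordinate ([escaping]); such a family must have mass beyond a
    prescribed index of l^{1/2} ([drop_base]).  Adding k such families with
    suitable signs makes N grow like k, because their masses sit essentially on
    disjoint indices, whereas the l^1 norm of the base is at most k ([growth]).
    After division by k^2 the base tends to 0 while N stays bounded below; a
    small lift of the base can be subtracted, which leaves an element of L that
    is small for tau2 and not small in Y ([large_kernel_element]).  This is the
    contradiction.

    The computations take place in a dense subspace of Y: the probability space
    is replaced by periodic sequences with their means, and l^{1/2} and l^1 by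
    finite sequences, that is, by polynomials.  Y is its completion. *)

Set Implicit Arguments.
Unset Strict Implicit.
Unset Printing Implicit Defensive.

Import Order.TTheory GRing.Theory Num.Theory.
Import numFieldNormedType.Exports.

Local Open Scope classical_set_scope.
Local Open Scope ring_scope.

(** * Separated quotients and completions of half-normed spaces *)

(** Typically N (x) = sum_s sqrt |x_s|: the square root of a 1/2-convex quasi-norm
    is subadditive, and is easier to handle than the quasi-norm itself. *)
Record halfNormedType (R : realType) := HalfNormedType {
  hn_sort :> lmodType R;
  hnorm : hn_sort -> R;
  hnorm_ge0 : forall x, 0 <= hnorm x;
  ler_hnormD : forall x y, hnorm (x + y) <= hnorm x + hnorm y;
  hnormZ : forall a x, hnorm (a *: x) = Num.sqrt `|a| * hnorm x }.

Section HalfNormed.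
Variables (R : realType) (V : halfNormedType R).
Implicit Types x y : V.

Lemma hnorm0 : hnorm (0 : V) = 0.
Proof. by rewrite -(scale0r 0) hnormZ normr0 sqrtr0 mul0r. Qed.

Lemma hnormN x : hnorm (- x) = hnorm x.
Proof. by rewrite -scaleN1r hnormZ normrN1 sqrtr1 mul1r. Qed.

Lemma hnorm_distC x y : hnorm (x - y) = hnorm (y - x).
Proof. by rewrite -opprB hnormN. Qed.

Lemma hnorm_triangle y x z : hnorm (x - z) <= hnorm (x - y) + hnorm (y - z).
Proof. by apply: le_trans (ler_hnormD _ _); rewrite addrA subrK. Qed.

Lemma ler_dist_hnorm x y : `|hnorm x - hnorm y| <= hnorm (x - y).
Proof.
have h (z t : V) : hnorm z <= hnorm (z - t) + hnorm t.
  by apply: le_trans (ler_hnormD _ _); rewrite subrK.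
have h1 := h x y; have := h y x; rewrite hnorm_distC => h2.
by rewrite ler_norml; apply/andP; split; lra.
Qed.

Definition hcauchy (u : nat -> V) := forall e, 0 < e ->
  exists N, forall m n, (N <= m)%N -> (N <= n)%N -> hnorm (u m - u n) < e.

Definition hcomplete := forall u, hcauchy u ->
  exists l, forall e, 0 < e -> exists N, forall n, (N <= n)%N -> hnorm (u n - l) < e.

End HalfNormed.

Section SeparatedQuotient.
Variables (R : realType) (V : halfNormedType R).
Local Open Scope quotient_scope.

Definition hnull (x : V) : bool := hnorm x == 0.

Lemma hnull_zmod_closed : zmod_closed hnull.
Proof.
split=> [|x y /eqP x0 /eqP y0]; first by apply/eqP; exact: hnorm0.
apply/eqP/le_anti; rewrite hnorm_ge0 andbT.
by apply: le_trans (ler_hnormD _ _) _; rewrite hnormN x0 y0 addr0.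
Qed.
HB.instance Definition _ := GRing.isZmodClosed.Build V hnull hnull_zmod_closed.

Definition hquot : Type := Quotient.quot (GRing.ZmodClosed.clone V hnull _).
HB.instance Definition _ := GRing.Zmodule.on hquot.
HB.instance Definition _ := ZmodQuotient.on hquot.

Lemma pi_hquotP x y : reflect (\pi_hquot x = \pi_hquot y) (hnorm (x - y) == 0).
Proof.
by apply: (iffP idP) => [h|/eqP]; [apply/eqP; rewrite -Quotient.idealrBE|
   rewrite -Quotient.idealrBE].
Qed.

Lemma hnorm_repr (x : V) : hnorm (repr (\pi_hquot x)) = hnorm x.
Proof.
have /pi_hquotP/eqP h : \pi_hquot (repr (\pi_hquot x)) = \pi_hquot x by rewrite reprK.
by apply/eqP; rewrite -subr_eq0 -normr_le0 -h ler_dist_hnorm.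
Qed.

Definition hquot_scale (a : R) : hquot -> hquot := lift_op1 hquot ( *:%R a).

Lemma pi_hquot_scale a x : \pi_hquot (a *: x) = hquot_scale a (\pi_hquot x).
Proof.
rewrite /hquot_scale; unlock; apply/esym/pi_hquotP; rewrite -scalerBr hnormZ.
have /pi_hquotP/eqP -> : \pi_hquot (repr (\pi_hquot x)) = \pi_hquot x by rewrite reprK.
by rewrite mulr0.
Qed.

Lemma hquot_scaleA a b x : hquot_scale a (hquot_scale b x) = hquot_scale (a * b) x.
Proof. by rewrite -[x]reprK -!pi_hquot_scale scalerA. Qed.
Lemma hquot_scale1 : left_id 1 hquot_scale.
Proof. by move=> x; rewrite -[x]reprK -pi_hquot_scale scale1r. Qed.
Lemma hquot_scaleDr : right_distributive hquot_scale +%R.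
Proof.
move=> a x y; rewrite -[x]reprK -[y]reprK -raddfD -!pi_hquot_scale -raddfD.
by rewrite scalerDr.
Qed.
Lemma hquot_scaleDl x : {morph hquot_scale^~ x : a b / a + b}.
Proof. by move=> a b; rewrite -[x]reprK -!pi_hquot_scale -raddfD scalerDl. Qed.
HB.instance Definition _ := GRing.Zmodule_isLmodule.Build R hquot
  hquot_scaleA hquot_scale1 hquot_scaleDr hquot_scaleDl.

Lemma pi_hquot_is_linear : linear (\pi_hquot : V -> hquot).
Proof. by move=> a x y; rewrite raddfD; congr (_ + _); exact: pi_hquot_scale. Qed.

Definition hquot_norm (q : hquot) : R := hnorm (repr q) ^+ 2.

Lemma hquot_normE x : hquot_norm (\pi_hquot x) = hnorm x ^+ 2.
Proof. by rewrite /hquot_norm hnorm_repr. Qed.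

Lemma hquot_norm_ge0 q : 0 <= hquot_norm q. Proof. exact: sqr_ge0. Qed.

Lemma hquot_norm_eq0 q : hquot_norm q = 0 -> q = 0.
Proof.
move=> /eqP; rewrite expf_eq0 /= => /eqP q0.
by rewrite -[q]reprK -[0]pi_zeror; apply/pi_hquotP; rewrite subr0 q0.
Qed.

Lemma hquot_normZ a q : hquot_norm (a *: q) = `|a| * hquot_norm q.
Proof.
rewrite -[q]reprK -[a *: _]pi_hquot_scale !hquot_normE hnormZ exprMn.
by rewrite sqr_sqrtr.
Qed.

Lemma hquot_norm_quasi : exists C, forall p q,
  hquot_norm (p + q) <= C * (hquot_norm p + hquot_norm q).
Proof.
exists 2 => p q; rewrite -[p]reprK -[q]reprK -raddfD !hquot_normE.
set x := repr p; set y := repr q.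
apply: le_trans (_ : (hnorm x + hnorm y) ^+ 2 <= _).
  by rewrite ler_pXn2r ?nnegrE ?addr_ge0 ?hnorm_ge0 ?ler_hnormD.
rewrite -subr_ge0; apply: le_trans (sqr_ge0 (hnorm x - hnorm y)) _.
by rewrite le_eqVlt; apply/orP; left; apply/eqP; ring.
Qed.

Lemma hquot_complete : hcomplete V -> forall u : nat -> hquot,
  (forall e, 0 < e -> exists N, forall m n, (N <= m)%N -> (N <= n)%N ->
     hquot_norm (u m - u n) < e) ->
  exists l, forall e, 0 < e -> exists N, forall n, (N <= n)%N ->
     hquot_norm (u n - l) < e.
Proof.
move=> Vc u uc.
have sq (x : V) e : 0 < e -> (hnorm x ^+ 2 < e ^+ 2) = (hnorm x < e).
  by move=> e0; rewrite ltr_pXn2r ?nnegrE ?hnorm_ge0 ?ltW.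
have [|l lP] := Vc (fun n => repr (u n)).
  move=> e e0; have [|N NP] := uc (e ^+ 2); first by rewrite exprn_gt0.
  exists N => m n Nm Nn; rewrite -sq // -hquot_normE raddfB /= !reprK; exact: NP.
exists (\pi_hquot l) => e e0.
have s0 : 0 < Num.sqrt e by rewrite sqrtr_gt0.
have [N NP] := lP _ s0; exists N => n Nn.
rewrite -[u n]reprK -raddfB hquot_normE -(sqr_sqrtr (ltW e0)) sq //; exact: NP.
Qed.

Lemma separated_quotient : hcomplete V ->
  exists (Y : quasiBanachType R) (p : {linear V -> Y}),
    [/\ forall y, exists x, p x = y,
        forall x, qnorm (p x) = hnorm x ^+ 2 &
        forall g : {linear V -> R^o}, (forall x, hnorm x = 0 -> g x = 0) ->
          exists h : {linear Y -> R^o}, forall x, h (p x) = g x].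
Proof.
move=> Vc.
pose Y := QuasiBanachType hquot_norm_ge0 hquot_norm_eq0 hquot_normZ
  hquot_norm_quasi (hquot_complete Vc).
pose piL := GRing.isLinear.Build R V hquot _ _ pi_hquot_is_linear.
pose p : {linear V -> hquot} := HB.pack (\pi_hquot : V -> hquot) piL.
exists Y, p; split.
- by move=> y; exists (repr y); exact: reprK.
- exact: hquot_normE.
- move=> g g0; pose h (q : hquot) : R^o := g (repr q).
  have hE x : h (\pi_hquot x) = g x.
    apply/eqP; rewrite -subr_eq0 -linearB; apply/eqP/g0/eqP/pi_hquotP.
    by rewrite reprK.
  have hL : linear h.
    move=> a x y; rewrite -[x]reprK -[y]reprK -[_ *: _]pi_hquot_scale -raddfD !hE.
    by rewrite linearP.
  pose hLm := GRing.isLinear.Build R hquot R^o _ _ hL.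
  by exists (HB.pack h hLm : {linear hquot -> R^o}).
Qed.

End SeparatedQuotient.

Section CauchySequences.
Variables (R : realType) (V : halfNormedType R).

Lemma real_cauchy_cvg (u : nat -> R) : (forall e, 0 < e -> exists N, forall m n,
  (N <= m)%N -> (N <= n)%N -> `|u m - u n| < e) -> cvgn u.
Proof.
move=> uc; apply/cauchy_cvgP/cauchy_exP => e e0; have [N NP] := uc e e0.
exists (u N); exists N => // n /= Nn; exact: NP.
Qed.

Definition cauchy_pred (u : nat -> V) : bool := `[< hcauchy u >].

Lemma cauchy_submod_closed : submod_closed cauchy_pred.
Proof.
split=> [|a u v /asboolP uc /asboolP vc]; apply/asboolP => e e0.
  by exists 0%N => m n _ _; rewrite subrr hnorm0.
have d0 : 0 < e / (2 * (Num.sqrt `|a| + 1)).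
  by rewrite divr_gt0 // mulr_gt0 // ltr_wpDl ?sqrtr_ge0.
have [N NP] := uc _ d0; have [M MP] := vc _ (divr_gt0 e0 (ltr0Sn R 1)).
exists (maxn N M) => m n; rewrite !geq_max => /andP[Nm Mm] /andP[Nn Mn].
rewrite !fctE opprD addrACA -scalerBr.
apply: le_lt_trans (ler_hnormD _ _) _; rewrite hnormZ [ltRHS]splitr.
apply: ler_ltD; last exact: MP.
have s0 : 0 < Num.sqrt `|a| + 1 by rewrite ltr_wpDl ?sqrtr_ge0.
apply: le_trans (_ : (Num.sqrt `|a| + 1) * hnorm (u m - u n) <= _).
  by rewrite ler_wpM2r ?hnorm_ge0 // lerDl.
rewrite mulrC -ler_pdivlMr // -mulrA -invfM ltW //; exact: NP.
Qed.
HB.instance Definition _ :=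
  GRing.isSubmodClosed.Build R (nat -> V) cauchy_pred cauchy_submod_closed.

Record cauchy_seq := CauchySeq { cseq :> nat -> V; _ : cauchy_pred cseq }.
HB.instance Definition _ := [isSub for cseq].
HB.instance Definition _ := [Choice of cauchy_seq by <:].
HB.instance Definition _ := [SubChoice_isSubLmodule of cauchy_seq by <:].
Implicit Types u v : cauchy_seq.

Lemma cseqP u : hcauchy u. Proof. by have /asboolP := valP u. Qed.

Definition cnorm u : R := limn (fun n => hnorm (u n)).

Lemma cnorm_cvg u : (fun n => hnorm (u n)) @ \oo --> cnorm u.
Proof.
apply: real_cauchy_cvg => e e0; have [N NP] := cseqP u e0.
by exists N => m n Nm Nn; apply: le_lt_trans (ler_dist_hnorm _ _) _; exact: NP.
Qed.

Lemma cnorm_ge0 u : 0 <= cnorm u.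
Proof.
apply: (@ler_cvg_to _ _ _ _ (fun=> 0) _ _ _ (cvg_cst _) (@cnorm_cvg u)).
by near=> n; exact: hnorm_ge0.
Unshelve. all: by end_near. Qed.

Lemma ler_cnormD u v : cnorm (u + v) <= cnorm u + cnorm v.
Proof.
apply: (ler_cvg_to (@cnorm_cvg _) (cvgD (@cnorm_cvg u) (@cnorm_cvg v))).
by near=> n; exact: ler_hnormD.
Unshelve. all: by end_near. Qed.

Lemma cnormZ a u : cnorm (a *: u) = Num.sqrt `|a| * cnorm u.
Proof.
apply/cvg_lim => //; rewrite [X in X @ _](_ : _ = fun n => Num.sqrt `|a| * hnorm (u n)).
  by apply: cvgMl_tmp; exact: cnorm_cvg.
by apply/funext => n; rewrite -hnormZ.
Qed.

Definition cauchy_space := HalfNormedType cnorm_ge0 ler_cnormD cnormZ.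

Lemma cauchy_cst (x : V) : cauchy_pred (fun=> x).
Proof. by apply/asboolP => e e0; exists 0%N => m n _ _; rewrite subrr hnorm0. Qed.
Definition ccst (x : V) : cauchy_seq := CauchySeq (cauchy_cst x).

Lemma ccst_is_linear : linear ccst.
Proof. by move=> a x y; apply: val_inj. Qed.
HB.instance Definition _ := GRing.isLinear.Build R V cauchy_seq _ ccst ccst_is_linear.

Lemma cnorm_ccst x : cnorm (ccst x) = hnorm x.
Proof. exact: (norm_lim_cst (hnorm x)). Qed.

Lemma cnorm_le u e : (exists N, forall n, (N <= n)%N -> hnorm (u n) <= e) -> cnorm u <= e.
Proof.
move=> [N NP].
apply: (@ler_cvg_to _ _ _ _ _ (fun=> e) _ _ (@cnorm_cvg u) (cvg_cst _)).
by exists N.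
Qed.

Lemma ccst_dense u e : 0 < e -> exists x, cnorm (u - ccst x) < e.
Proof.
move=> e0; have [N NP] := cseqP u (divr_gt0 e0 (ltr0Sn R 1)).
exists (u N); apply: le_lt_trans (_ : e / 2 < e); last by rewrite ltr_pdivrMr // ltr_pMr // ltr1n.
by apply: cnorm_le; exists N => n Nn; apply/ltW/NP.
Qed.

(** Each term of a Cauchy sequence of Cauchy sequences is replaced by a constant
    sequence 1/(n+1)-close to it; the sequence of these constants is a limit. *)
Lemma cauchy_space_complete : hcomplete cauchy_space.
Proof.
move=> u uc.
have /choice[x xP] n : exists x, cnorm (u n - ccst x) < n.+1%:R^-1.
  by apply: ccst_dense; rewrite invr_gt0.
have arch e : 0 < e -> exists N, forall n, (N <= n)%N -> n.+1%:R^-1 < e :> R.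
  move=> e0; exists (Num.trunc e^-1) => n Nn.
  rewrite invf_plt ?posrE //; apply: lt_le_trans (truncnS_gt _) _.
  by rewrite ler_nat.
have xc : hcauchy x.
  move=> e e0; have e30 : 0 < e / 3 by rewrite divr_gt0.
  have [N NP] := uc _ e30; have [M MP] := arch _ e30.
  exists (maxn N M) => m n; rewrite !geq_max => /andP[Nm Mm] /andP[Nn Mn].
  rewrite -cnorm_ccst linearB /=.
  have h1 : cnorm (ccst (x m) - ccst (x n)) <= cnorm (u m - ccst (x m)) +
      (cnorm (u m - u n) + cnorm (u n - ccst (x n))).
    apply: le_trans (@hnorm_triangle _ cauchy_space (u m) _ _) _.
    rewrite hnorm_distC lerD2l.
    exact: (@hnorm_triangle _ cauchy_space (u n)).
  have h3 : cnorm (u m - u n) < e / 3 := NP m n Nm Nn.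
  have h4 := lt_trans (xP m) (MP m Mm); have h5 := lt_trans (xP n) (MP n Mn).
  lra.
have xp : cauchy_pred x by apply/asboolP.
exists (CauchySeq xp) => e e0; have e20 : 0 < e / 2 by rewrite divr_gt0.
have [N NP] := xc _ e20; have [M MP] := arch _ e20.
exists (maxn N M) => n; rewrite geq_max => /andP[Nn Mn].
apply: le_lt_trans (@hnorm_triangle _ cauchy_space (ccst (x n)) _ _) _.
rewrite [ltRHS]splitr; apply: ltr_leD; first exact: lt_trans (xP n) (MP n Mn).
by apply: cnorm_le; exists N => k Nk; apply/ltW/NP.
Qed.

Lemma functional_extends (g : {linear V -> R^o}) C : 0 <= C ->
  (forall x, `|g x| <= C * hnorm x ^+ 2) ->
  exists h : {linear cauchy_seq -> R^o}, (forall x, h (ccst x) = g x) /\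
    forall u, `|h u| <= C * cnorm u ^+ 2.
Proof.
move=> C0 gC; pose h u : R^o := limn (fun n => g (u n) : R).
have h_cvg u : (fun n => g (u n) : R) @ \oo --> (h u : R).
  apply: real_cauchy_cvg => e e0.
  have e'0 : 0 < e / (C + 1) by rewrite divr_gt0 // ltr_wpDl.
  have [|N NP] := cseqP u (e := Num.sqrt (e / (C + 1))); first by rewrite sqrtr_gt0.
  exists N => m n Nm Nn; rewrite -[_ - _](linearB g).
  apply: le_lt_trans (gC _) _.
  apply: le_lt_trans (_ : C * (e / (C + 1)) < e).
    rewrite ler_wpM2l // -[leRHS]sqr_sqrtr ?ltW //.
    by rewrite ltr_pXn2r ?nnegrE ?hnorm_ge0 ?sqrtr_ge0 //; exact: NP.
  by rewrite mulrA ltr_pdivrMr ?ltr_wpDl // mulrC ltr_pM2l // ltrDl.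
have hL : linear h.
  move=> a u v; apply/cvg_lim => //.
  rewrite [X in X @ _](_ : _ = fun n => a * g (u n) + g (v n)).
    by apply: cvgD => //; apply: cvgMl_tmp.
  by apply/funext => n; rewrite /= !fctE linearP.
pose hLm := GRing.isLinear.Build R cauchy_seq R^o _ _ hL.
exists (HB.pack h hLm : {linear cauchy_seq -> R^o}); split.
  by move=> x; exact: (norm_lim_cst (g x : R)).
move=> u; apply: (ler_cvg_to (cvg_norm (@h_cvg u))
  (cvgMl_tmp (cvgM (@cnorm_cvg u) (@cnorm_cvg u)))).
by near=> n; have := gC (u n); rewrite expr2.
Unshelve. all: by end_near. Qed.

(** The completion is the separated quotient of the space of Cauchy sequences,
    normed by the limit of the norms. *)
Lemma half_normed_completion : exists (Y : quasiBanachType R) (i : {linear V -> Y}),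
  [/\ forall x, qnorm (i x) = hnorm x ^+ 2,
      forall y z : Y, Num.sqrt (qnorm (y + z)) <= Num.sqrt (qnorm y) + Num.sqrt (qnorm z),
      forall y e, 0 < e -> exists x, qnorm (y - i x) < e &
      forall (g : {linear V -> R^o}) C, 0 <= C -> (forall x, `|g x| <= C * hnorm x ^+ 2) ->
        exists h : {linear Y -> R^o}, (forall x, h (i x) = g x) /\
          forall y, `|h y| <= C * qnorm y].
Proof.
have [Y [p [pS pN pF]]] := separated_quotient cauchy_space_complete.
exists Y, (p \o ccst)%FUN; split.
- by move=> x; rewrite /= pN /= cnorm_ccst.
- move=> y z; have [u <-] := pS y; have [v <-] := pS z.
  rewrite -linearD !pN !sqrtr_sqr !ger0_norm ?hnorm_ge0 //; exact: ler_hnormD.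
- move=> y e e0; have [u <-] := pS y.
  have [|x xP] := @ccst_dense u (Num.sqrt e); first by rewrite sqrtr_gt0.
  exists x; rewrite /= -linearB pN -[ltRHS]sqr_sqrtr ?ltW //.
  by rewrite ltr_pXn2r ?nnegrE ?hnorm_ge0 ?sqrtr_ge0.
- move=> g C C0 gC; have [h [hg hC]] := functional_extends C0 gC.
  have [|k kP] := pF h.
    move=> u u0; apply/eqP; rewrite -normr_le0.
    by apply: le_trans (hC u) _; rewrite [cnorm u]u0 expr0n mulr0.
  exists k; split; first by move=> x; rewrite /= kP hg.
  by move=> y; have [u <-] := pS y; rewrite kP pN; exact: hC.
Qed.

End CauchySequences.

(** A functional scales like the square of hnorm, so a bound on a ball is a bound
    by a multiple of that square. *)
Lemma bounded_near0 (R : realType) (V : halfNormedType R) (g : {linear V -> R^o}) A e :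
  0 < e -> (forall x, hnorm x ^+ 2 < e -> `|g x| <= A) ->
  forall x, `|g x| <= A / e * hnorm x ^+ 2.
Proof.
move=> e0 gA x; have A0 : 0 <= A.
  by have := gA 0; rewrite hnorm0 expr0n linear0 normr0; exact.
set s := hnorm x ^+ 2; have s0 : 0 <= s by exact: sqr_ge0.
(* hnorm x may vanish, so x is scaled by e / (hnorm x ^+ 2 + r) with r > 0. *)
apply/ler_addgt0Pr => d d0.
pose r := d * e / (A + 1); have r0 : 0 < r.
  by rewrite divr_gt0 ?mulr_gt0 // ltr_wpDl.
have sr : 0 < s + r by rewrite ltr_wpDl.
have t0 : 0 < e / (s + r) by rewrite divr_gt0.
have := gA ((e / (s + r)) *: x); rewrite hnormZ exprMn sqr_sqrtr // -/s.
rewrite gtr0_norm // mulrAC ltr_pdivrMr // ltr_pM2l // ltrDl => /(_ r0).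
rewrite linearZ /= normrM gtr0_norm // mulrC -ler_pdivlMr // invf_div => h.
apply: le_trans h _; rewrite mulrA ler_pdivrMr // mulrDr mulrDl.
rewrite mulrAC divfK ?gt_eqF // lerD2l /r mulrA ler_pdivrMr ?ltr_wpDl //.
rewrite mulrC ler_pM2l ?mulr_gt0 //; lra.
Qed.

(** * Linear functionals and neighbourhood bases *)

(** The properties of the balanced neighbourhoods of 0 that the argument uses,
    stated without a topology so that they can be pulled back along a linear map
    to a dense subspace. *)
Record zero_base (R : realType) (E : lmodType R) (B : set_system E) : Prop := {
  zb_zero : forall U, B U -> U 0;
  zb_balanced : forall U a x, B U -> `|a| <= 1 -> U x -> U (a *: x);
  zb_add : forall U, B U -> exists2 V, B V & forall x y, V x -> V y -> U (x + y);
  zb_scale : forall U a, B U -> exists2 V, B V & forall x, V x -> U (a *: x);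
  zb_cap : forall U V, B U -> B V -> exists2 W, B W & W `<=` U `&` V }.

Lemma zb_sub (R : realType) (E : lmodType R) (B : set_system E) :
  zero_base B -> forall U, B U -> exists2 V, B V & forall x y, V x -> V y -> U (x - y).
Proof.
move=> zb U /(zb_add zb)[V BV VU]; exists V => // x y Vx Vy; apply: VU => //.
by rewrite -scaleN1r; apply: (zb_balanced zb) => //; rewrite normrN1.
Qed.

(** Elimination of phi_m from a bound on psi by |phi_0|, ..., |phi_m|.  If phi_m
    is itself bounded by the previous functionals, its bound is substituted.
    Otherwise every neighbourhood contains vectors y with phi_m (y) = 1 on which
    the previous functionals are as small as desired; along these vectors psi (y)
    has a limit c, and psi - c phi_m is bounded by the previous functionals. *)
Section CommonKernel.
Variables (R : realType) (E : lmodType R) (B : set_system E).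
Hypothesis zb : zero_base B.
Implicit Types (psi : {linear E -> R^o}).

Section Step.
Variables (phi : nat -> {linear E -> R^o}) (m : nat).
Let S x := \sum_(i < m) `|phi i x|.

Let S_ge0 x : 0 <= S x. Proof. exact: sumr_ge0. Qed.
Let SZ a x : S (a *: x) = `|a| * S x.
Proof. by rewrite /S mulr_sumr; apply: eq_bigr => i _; rewrite linearZ /= normrM. Qed.
Let SB x y : S (x - y) <= S x + S y.
Proof. by rewrite /S -big_split; apply: ler_sum => i _; rewrite linearB /= ler_normB. Qed.

Let Z V d y := [/\ V y, phi m y = 1 & S y <= d].

Hypothesis unbounded : ~ exists V A C, [/\ B V, 0 <= C &
  forall x, V x -> `|phi m x| <= A + C * S x].

Let Z_nonempty V d : B V -> 0 < d -> exists y, Z V d y.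
Proof.
move=> BV d0; apply: contrapT => nZ; apply: unbounded; exists V, 1, d^-1.
split; rewrite ?invr_ge0 ?ltW //.
move=> x Vx; rewrite leNgt; apply/negP => h; apply: nZ.
have p1 : 1 < `|phi m x|.
  by apply: le_lt_trans h; rewrite lerDl mulr_ge0 // invr_ge0 ltW.
have p0 : 0 < `|phi m x| by apply: lt_trans p1.
exists ((phi m x)^-1 *: x); split.
- by apply: (zb_balanced zb) => //; rewrite normfV invf_le1 // ltW.
- by rewrite linearZ; apply: mulVf; rewrite -normr_gt0.
- rewrite SZ normfV ler_pdivrMl // mulrC -ler_pdivrMl //.
  by apply/ltW/(le_lt_trans _ h); rewrite lerDr.
Qed.

Variables (psi : {linear E -> R^o}) (U : set E) (A C : R).
Hypotheses (BU : B U) (C0 : 0 <= C).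
Hypothesis psiU : forall x, U x -> phi m x = 0 -> `|psi x| <= A + C * S x.

Let A0 : 0 <= A.
Proof.
have := psiU (zb_zero zb BU) (linear0 _); rewrite /S linear0 normr0 big1 ?mulr0 ?addr0 //.
by move=> i _; rewrite linear0 normr0.
Qed.

(* On differences y - y' the functional phi_m vanishes, so the bound on psi only
   involves the previous functionals. *)
Let oscillation e : 0 < e -> exists V d, [/\ B V, 0 < d &
  forall y y', Z V d y -> Z V d y' -> `|psi y - psi y'| <= e].
Proof.
move=> e0; pose t := e / (2 * (A + 1)).
have t0 : 0 < t by rewrite divr_gt0 // mulr_gt0 // ltr_wpDl.
have [V1 BV1 V1U] := zb_scale zb t^-1 BU.
have [V BV VV1] := zb_sub zb BV1.
pose d := e / (4 * (C + 1)).
have d0 : 0 < d by rewrite divr_gt0 // mulr_gt0 // ltr_wpDl.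
exists V, d; split => // y y' [Vy py Sy] [Vy' py' Sy'].
have := psiU (V1U _ (VV1 _ _ Vy Vy')).
rewrite linearZ linearB /= py py' subrr scaler0 => /(_ erefl).
rewrite -linearB linearZ /= normrM SZ normfV (gtr0_norm t0) => h.
have : `|psi (y - y')| <= t * A + C * S (y - y').
  by move: h; rewrite ler_pdivrMl // mulrDr mulrCA mulVKf ?gt_eqF.
move=> {}h; apply: le_trans h _.
have SB' : C * S (y - y') <= C * (d + d).
  by rewrite ler_wpM2l // (le_trans (SB _ _)) // lerD.
have tA : t * A <= e / 2.
  rewrite /t -mulrA [_^-1 * A]mulrC ler_wpM2l ?(ltW e0) //.
  by rewrite ler_pdivrMr ?mulr_gt0 ?ltr_wpDl // mulrA mulVf ?mul1r ?lerDl.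
have Cd : C * (d + d) <= e / 2.
  have -> : C * (d + d) = e * (C / (2 * (C + 1))).
    by rewrite /d; field; rewrite gt_eqF // ltr_wpDl.
  rewrite ler_wpM2l ?(ltW e0) // ler_pdivrMr ?mulr_gt0 ?ltr_wpDl //.
  by rewrite mulrA mulVf ?mul1r ?lerDl.
lra.
Qed.

Let limit_value : exists c, forall e, 0 < e -> exists V d, [/\ B V, 0 < d &
  forall y, Z V d y -> `|psi y - c| <= e].
Proof.
(* c is the supremum of the lower bounds of psi on the sets Z V d. *)
pose L := [set a | exists V d, [/\ B V, 0 < d & forall y, Z V d y -> a <= psi y]].
have Lub V d e y : B V -> 0 < d -> (forall y y', Z V d y -> Z V d y' ->
    `|psi y - psi y'| <= e) -> Z V d y -> ubound L (psi y + e).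
  move=> BV d0 osc Zy a [V' [d' [BV' d'0 aP]]].
  have [W BW WVV'] := zb_cap zb BV BV'.
  have [|y' [Wy' py' Sy']] := @Z_nonempty W (Num.min d d') BW; first by rewrite lt_min d0.
  move: Sy'; rewrite le_min => /andP[Sd Sd']; have [Vy' V'y'] := WVV' _ Wy'.
  apply: le_trans (aP y' _) _ => //.
  by have := osc y' y (And3 Vy' py' Sd) Zy; rewrite ler_norml => /andP[_]; lra.
have Lin V d e y : B V -> 0 < d -> (forall y y', Z V d y -> Z V d y' ->
    `|psi y - psi y'| <= e) -> Z V d y -> L (psi y - e).
  move=> BV d0 osc Zy; exists V, d; split => // y' Zy'.
  by have := osc y y' Zy Zy'; rewrite ler_norml => /andP[_]; lra.
exists (sup L) => e e0; have [V [d [BV d0 osc]]] := oscillation e0.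
exists V, d; split => // y Zy.
have Ly := Lin V d e y BV d0 osc Zy; have Uy := Lub V d e y BV d0 osc Zy.
have h1 : sup L <= psi y + e by apply: ge_sup => //; exists (psi y - e).
have h2 : psi y - e <= sup L by apply: ub_le_sup => //; exists (psi y + e).
by rewrite ler_norml; apply/andP; split; lra.
Qed.

(** For t = phi_m (v), the vector v - t y lies in the kernel of phi_m when y is one
    of the vectors with phi_m (y) = 1; taking y small enough in terms of t, the
    bound on psi (v - t y) becomes one on psi (v) - c t. *)
Lemma subtract_unbounded : exists (c : R) V A', B V /\
  forall x, V x -> `|psi x - c * phi m x| <= A' + C * S x.
Proof.
have [c cP] := limit_value; exists c.
have [V BV VU] := zb_sub zb BU.
exists V, (A + C + 1); split => // v Vv; set t : R := phi m v.
have t1 : 0 < `|t| + 1 by rewrite ltr_wpDl.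
have e0 : 0 < (`|t| + 1)^-1 by rewrite invr_gt0.
have [V2 [d2 [BV2 d20 cV2]]] := cP _ e0.
have [V3 BV3 V3V] := zb_scale zb t BV.
have [W BW W23] := zb_cap zb BV2 BV3.
have [|y [Wy py]] := @Z_nonempty W (Num.min d2 (`|t| + 1)^-1) BW.
  by rewrite lt_min d20.
rewrite le_min => /andP[Sd2 Se]; have [V2y V3y] := W23 _ Wy.
have small a : 0 <= a -> a <= (`|t| + 1)^-1 -> `|t| * a <= 1.
  move=> a0 h; apply: le_trans (ler_wpM2l (normr_ge0 t) h) _.
  by rewrite ler_pdivrMr // mul1r lerDl.
have h1 := small _ (normr_ge0 _) (cV2 y (And3 V2y py Sd2)).
have h2 := small _ (S_ge0 y) Se.
have pz : phi m (v - t *: y) = 0.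
  rewrite linearB linearZ /= py.
  exact: etrans (congr1 (fun z => t - z) (mulr1 t)) (subrr t).
have := psiU (VU _ _ Vv (V3V _ V3y)) pz.
rewrite linearB linearZ /= -[t *: psi y]/(t * psi y) => h3.
have : C * S (v - t *: y) <= C * (S v + 1).
  by rewrite ler_wpM2l // (le_trans (SB _ _)) // lerD2l SZ.
have : `|psi v - c * t| <= `|psi v - t * psi y| + `|t| * `|psi y - c|.
  rewrite -normrM; apply: le_trans (ler_normD _ _).
  by rewrite mulrBr addrA subrK [t * c]mulrC.
lra.
Qed.

End Step.

Hypothesis trivial_dual : forall psi U A, B U -> (forall x, U x -> `|psi x| <= A) ->
  forall x, psi x = 0.

(** When all the phi_i have been eliminated, a combination of psi and of the phi_i
    is bounded, hence 0. *)
Lemma common_kernel (phi : nat -> {linear E -> R^o}) m psi U A C : B U -> 0 <= C ->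
  (forall x, U x -> `|psi x| <= A + C * \sum_(i < m) `|phi i x|) ->
  forall x, (forall i, (i < m)%N -> phi i x = 0) -> psi x = 0.
Proof.
elim: m psi U A C => [|m IH] psi U A C BU C0 psiU x phi0.
  apply: (trivial_dual BU (A := A)) => y /psiU.
  by rewrite big_ord0 mulr0 addr0.
pose S x := \sum_(i < m) `|phi i x|.
have phi0' i : (i < m)%N -> phi i x = 0 by move=> im; rewrite phi0 // ltnW.
have [[V [A' [C' [BV C'0 phiV]]]]|unb] := pselect (exists V A C, [/\ B V, 0 <= C &
  forall x, V x -> `|phi m x| <= A + C * S x]).
  have [W BW WUV] := zb_cap zb BU BV.
  apply: (IH psi W (A + C * A') (C + C * C') BW _ _ x phi0').
    by rewrite addr_ge0 // mulr_ge0.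
  move=> y /WUV[/psiU Uy /phiV Vy]; apply: le_trans Uy _.
  rewrite big_ord_recr /= -/(S y).
  have := ler_wpM2l C0 Vy; rewrite !mulrDr mulrDl mulrA; lra.
have phi00 : phi m x = 0 by exact: phi0.
have [|c [V [A' [BV h]]]] := @subtract_unbounded phi m unb psi U A C BU C0.
  by move=> y /psiU Uy py; move: Uy; rewrite big_ord_recr /= py normr0 addr0.
have := IH (psi \- c \*: phi m) V A' C BV C0 h x phi0'.
by rewrite /= phi00 scaler0 subr0.
Qed.

End CommonKernel.

Section VectorTopology.
Variables (R : realType) (Z : topologicalLmodType R).
Implicit Types U : set Z.

Lemma nbhs0_add U : nbhs 0 U -> exists2 V, nbhs 0 V & forall x y, V x -> V y -> U (x + y).
Proof.
move=> U0; have := @add_continuous Z (0, 0) U; rewrite /= addr0 => /(_ U0).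
move=> [[A1 A2] [/= hA1 hA2] h]; exists (A1 `&` A2); first exact: filterI.
by move=> x y [x1 _] [_ y2]; apply: (h (x, y)).
Qed.

Lemma nbhs0_scale (a : R) U : nbhs 0 U -> nbhs 0 [set x : Z | U (a *: x)].
Proof.
move=> U0; have := @scale_continuous R Z (a, 0) U; rewrite /= scaler0 => /(_ U0).
move=> [[A1 A2] [/= hA1 hA2] h]; apply: filterS hA2 => x x2.
by apply: (h (a, x)); split => //=; exact: nbhs_singleton.
Qed.

Lemma nbhs0_translate (x : Z) U : nbhs 0 U -> nbhs x [set y | U (y - x)].
Proof.
move=> U0; have := @sub_continuous Z (x, x) U; rewrite /= subrr => /(_ U0).
move=> [[A1 A2] [/= hA1 hA2] h]; apply: filterS hA1 => y y1.
by apply: (h (y, x)); split => //=; exact: nbhs_singleton.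
Qed.

Definition balanced_nbhs U := nbhs 0 U /\ forall (a : R) x, `|a| <= 1 -> U x -> U (a *: x).

Lemma nbhs0_balanced U : nbhs 0 U -> exists2 V, balanced_nbhs V & V `<=` U.
Proof.
move=> U0; have := @scale_continuous R Z (0, 0) U; rewrite /= scaler0 => /(_ U0).
move=> [[A1 A2] [/= /nbhs_ballP[d /= d0 dA1] hA2] h].
exists [set y | exists a x, [/\ `|a| < d, A2 x & y = a *: x :> Z]]; last first.
  move=> _ [a [x [ad x2 ->]]]; apply: (h (a, x)); split => //=; apply: dA1.
  by rewrite /ball /= sub0r normrN.
split; last first.
  move=> a _ a1 [b [x [bd x2 ->]]]; exists (a * b), x; rewrite scalerA; split => //.
  by apply: le_lt_trans bd; rewrite normrM ler_piMl.
have d20 : d / 2 != 0 by rewrite gt_eqF // divr_gt0.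
apply: filterS (nbhs0_scale (d / 2)^-1 hA2) => x /= x2.
exists (d / 2), ((d / 2)^-1 *: x); split => //; last by rewrite scalerA mulfV ?scale1r.
by rewrite gtr0_norm ?divr_gt0 // ltr_pdivrMr // ltr_pMr // ltr1n.
Qed.

Lemma balanced_nbhs_base : zero_base balanced_nbhs.
Proof.
split.
- by move=> U [U0 _]; exact: nbhs_singleton.
- by move=> U a x [_ Ub]; exact: Ub.
- move=> U [U0 _]; have [V V0 VU] := nbhs0_add U0.
  by have [W Wb WV] := nbhs0_balanced V0; exists W => // x y /WV Vx /WV Vy; exact: VU.
- move=> U a [U0 _]; have [W Wb WV] := nbhs0_balanced (nbhs0_scale a U0).
  by exists W.
- move=> U V [U0 Ub] [V0 Vb]; exists (U `&` V) => //; split; first exact: filterI.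
  by move=> a x a1 [Ux Vx]; split; [exact: Ub|exact: Vb].
Qed.

Lemma bounded_continuous (f : {linear Z -> R^o}) U A : nbhs 0 U ->
  (forall x, U x -> `|f x| <= A) -> continuous f.
Proof.
move=> U0 fA x; apply/(@cvgrPdist_lt _ R^o) => e e0.
have A0 : 0 <= A.
  by have := fA 0 (nbhs_singleton U0); rewrite linear0 normr0.
have A1 : 0 < A + 1 by rewrite ltr_wpDl.
apply: filterS (nbhs0_translate x (nbhs0_scale ((A + 1) / e) U0)) => y /= /fA.
rewrite linearZ linearB /= normrM gtr0_norm ?divr_gt0 // mulrAC ler_pdivrMr // => h.
rewrite distrC -(ltr_pM2l A1); apply: le_lt_trans h _.
by rewrite ltr_pM2r // ltrDl.
Qed.

Lemma continuous_bounded (f : {linear Z -> R^o}) : continuous f ->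
  nbhs 0 [set x | `|f x| < 1].
Proof.
move=> fc; have /(@cvgrPdist_lt _ R^o) /(_ 1 ltr01) := fc 0.
by apply: filterS => x; rewrite linear0 sub0r normrN.
Qed.

End VectorTopology.

Lemma zero_base_preimage (R : realType) (E Z : lmodType R) (i : {linear E -> Z}) B :
  zero_base B -> zero_base [set i @^-1` U | U in B].
Proof.
move=> zb; split.
- by move=> _ [U BU <-]; rewrite /= linear0; exact: (zb_zero zb).
- by move=> _ a x [U BU <-] a1 /= Ux; rewrite linearZ; exact: (zb_balanced zb).
- move=> _ [U BU <-]; have [V BV VU] := zb_add zb BU.
  by exists (i @^-1` V); [exists V | move=> x y Vx Vy /=; rewrite linearD; exact: VU].
- move=> _ a [U BU <-]; have [V BV VU] := zb_scale zb a BU.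
  by exists (i @^-1` V); [exists V | move=> x Vx /=; rewrite linearZ; exact: VU].
- move=> _ _ [U BU <-] [V BV <-]; have [W BW WUV] := zb_cap zb BU BV.
  by exists (i @^-1` W); [exists W | move=> x /WUV].
Qed.

Section Supremum.
Variables (K : numFieldType) (Y : lmodType K) (tau tau1 tau2 : topology_on Y).
Hypothesis tauP : is_supremum tau tau1 tau2.

Let Tc := fun b : bool =>
    if b then Topological.on (endow tau1) else Topological.on (endow tau2).
Let S := sup_topology Tc.

Lemma sup_finer b O : opens (if b then tau1 else tau2) O -> opens tau O.
Proof.
move=> Oo; rewrite tauP -/S openE => y Oy.
have /(_ b O) := (cvg_sup Tc y (nbhs_filter (y : S))).1 (@cvg_id _ _) .
apply; case: b Oo => Oo.
  exact: (@open_nbhs_nbhs (endow tau1) y O).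
exact: (@open_nbhs_nbhs (endow tau2) y O).
Qed.

Lemma sup_open O y : opens tau O -> O y -> exists O1 O2,
  [/\ opens tau1 O1 /\ O1 y, opens tau2 O2 /\ O2 y & O1 `&` O2 `<=` O].
Proof.
move=> Oo Oy.
(* The neighbourhood filter of y for the supremum. *)
pose F : set_system Y := [set A | exists O1 O2,
  [/\ opens tau1 O1 /\ O1 y, opens tau2 O2 /\ O2 y & O1 `&` O2 `<=` A]].
have FF : Filter F.
  split.
  - by exists setT, setT; split => //; split => //; exact: opensT.
  - move=> A B [A1 [A2 [[oA1 A1y] [oA2 A2y] A12]]] [B1 [B2 [[oB1 B1y] [oB2 B2y] B12]]].
    exists (A1 `&` B1), (A2 `&` B2); split; try by split => //; exact: opensI.
    by move=> z [[za1 zb1] [za2 zb2]]; split; [exact: A12|exact: B12].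
  - move=> A B AB [ O1 [ O2 [h1 h2 h]]]; exists O1, O2; split => //.
    exact: subset_trans AB.
have Fy : F --> (y : S).
  apply/(cvg_sup Tc y FF) => -[] A /=.
    rewrite (@nbhsE (endow tau1)) => -[ O1 [oO1 O1y] O1A].
    exists O1, setT; split => //; first by split => //; exact: opensT.
    by move=> z [/O1A].
  rewrite (@nbhsE (endow tau2)) => -[ O2 [oO2 O2y] O2A].
  exists setT, O2; split => //; first by split => //; exact: opensT.
  by move=> z [_ /O2A].
apply: Fy; apply: (@open_nbhs_nbhs S y O); split => //.
by move: Oo; rewrite tauP.
Qed.

End Supremum.

(** * The spaces l^1 and l^{1/2} of finite sequences *)

Section CoefSum.
Variable R : realType.
Implicit Types (g : R -> R) (v w : {poly R}).

Definition coef_sum g v := \sum_(s < size v) g v`_s.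

Lemma coef_sumE g m v : g 0 = 0 -> (size v <= m)%N ->
  coef_sum g v = \sum_(s < m) g v`_s.
Proof.
move=> g0 vm; rewrite /coef_sum (big_ord_widen m (fun s => g v`_s)) // big_mkcond.
apply: eq_bigr => i _; case: ltnP => // /leq_sizeP h.
by rewrite h.
Qed.

Lemma coef_sum_ge0 g v : (forall a, 0 <= g a) -> 0 <= coef_sum g v.
Proof. by move=> gp; apply: sumr_ge0. Qed.

Lemma ler_coef_sumD g v w : g 0 = 0 -> (forall a b, g (a + b) <= g a + g b) ->
  coef_sum g (v + w) <= coef_sum g v + coef_sum g w.
Proof.
move=> g0 gD; pose m := maxn (size v) (size w).
rewrite !(@coef_sumE g m) ?leq_maxl ?leq_maxr ?size_polyD // -big_split /=.
by apply: ler_sum => i _; rewrite coefD.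
Qed.

Lemma coef_sumZ g c d v : g 0 = 0 -> (forall a, g (c * a) = d * g a) ->
  coef_sum g (c *: v) = d * coef_sum g v.
Proof.
move=> g0 gM; rewrite !(@coef_sumE g (size v)) ?size_scale_leq // mulr_sumr.
by apply: eq_bigr => i _; rewrite coefZ.
Qed.

Definition l1norm := coef_sum (fun a => `|a|).

(** The square root of the quasi-norm of l^{1/2}, which is subadditive. *)
Definition lhalf := coef_sum (fun a => Num.sqrt `|a|).

Lemma sqrtN0 : Num.sqrt `|0 : R| = 0. Proof. by rewrite normr0 sqrtr0. Qed.

Lemma sqrt_le_sum (a b c : R) : 0 <= b -> 0 <= c -> a <= b + c ->
  Num.sqrt a <= Num.sqrt b + Num.sqrt c.
Proof.
move=> b0 c0 abc; have [a0|/ltW/ler0_sqrtr ->] := leP 0 a; last first.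
  by rewrite addr_ge0 ?sqrtr_ge0.
rewrite -(@ler_pXn2r _ 2) ?nnegrE ?addr_ge0 ?sqrtr_ge0 //.
rewrite sqrrD !sqr_sqrtr //.
have : 0 <= Num.sqrt b * Num.sqrt c by rewrite mulr_ge0 ?sqrtr_ge0.
by move: (Num.sqrt b * Num.sqrt c) => t t0; rewrite -mulr_natl; lra.
Qed.

Lemma sqrt_normD (a b : R) :
  Num.sqrt `|a + b| <= Num.sqrt `|a| + Num.sqrt `|b|.
Proof. by apply: sqrt_le_sum; rewrite ?ler_normD. Qed.

Lemma sqrt_normM (a b : R) :
  Num.sqrt `|a * b| = Num.sqrt `|a| * Num.sqrt `|b|.
Proof. by rewrite normrM sqrtrM. Qed.

Lemma l1norm_ge0 v : 0 <= l1norm v. Proof. exact: coef_sum_ge0. Qed.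
Lemma lhalf_ge0 v : 0 <= lhalf v.
Proof. by apply: coef_sum_ge0 => a; exact: sqrtr_ge0. Qed.

Lemma ler_l1normD v w : l1norm (v + w) <= l1norm v + l1norm w.
Proof. by apply: ler_coef_sumD; [exact: normr0|exact: ler_normD]. Qed.

Lemma l1normZ a v : l1norm (a *: v) = `|a| * l1norm v.
Proof. by apply: coef_sumZ => [|b]; rewrite ?normr0 ?normrM. Qed.

Lemma ler_lhalfD v w : lhalf (v + w) <= lhalf v + lhalf w.
Proof. by apply: ler_coef_sumD; [exact: sqrtN0|exact: sqrt_normD]. Qed.

Lemma lhalfZ a v : lhalf (a *: v) = Num.sqrt `|a| * lhalf v.
Proof. by apply: coef_sumZ => [|b]; rewrite ?sqrtN0 ?sqrt_normM. Qed.

Lemma lhalf0 : lhalf 0 = 0.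
Proof. by rewrite /lhalf /coef_sum size_poly0 big_ord0. Qed.

Lemma l1norm0 : l1norm 0 = 0.
Proof. by rewrite /l1norm /coef_sum size_poly0 big_ord0. Qed.

Lemma lhalf_sum (I : Type) (r : seq I) (F : I -> {poly R}) :
  lhalf (\sum_(i <- r) F i) <= \sum_(i <- r) lhalf (F i).
Proof.
elim/big_ind2: _ => //; first by rewrite lhalf0.
by move=> x a y b xa yb; apply: le_trans (ler_lhalfD _ _) _; apply: lerD.
Qed.

Lemma l1norm_sum (I : Type) (r : seq I) (F : I -> {poly R}) :
  l1norm (\sum_(i <- r) F i) <= \sum_(i <- r) l1norm (F i).
Proof.
elim/big_ind2: _ => //; first by rewrite l1norm0.
by move=> x a y b xa yb; apply: le_trans (ler_l1normD _ _) _; apply: lerD.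
Qed.

Lemma lhalfZXn a n : lhalf (a *: 'X^n) = Num.sqrt `|a|.
Proof.
rewrite lhalfZ /lhalf /coef_sum size_polyXn big_ord_recr /= big1 ?add0r.
  by rewrite coefXn eqxx normr1 sqrtr1 mulr1.
by move=> i _; rewrite coefXn (ltn_eqF (ltn_ord i)) sqrtN0.
Qed.

Lemma l1normXn n : l1norm 'X^n = 1.
Proof.
rewrite /l1norm /coef_sum size_polyXn big_ord_recr /= big1 ?add0r.
  by rewrite coefXn eqxx normr1.
by move=> i _; rewrite coefXn (ltn_eqF (ltn_ord i)) normr0.
Qed.

Lemma l1norm0P v : l1norm v = 0 -> v = 0.
Proof.
move=> /eqP; rewrite psumr_eq0 // => /allP h; apply/polyP => i; rewrite coef0.
have [iv|vi] := ltnP i (size v); last by rewrite nth_default.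
have /= := h (Ordinal iv) (mem_index_enum _).
by rewrite normr_eq0 => /eqP.
Qed.

Lemma l1norm_coef v i : `|v`_i| <= l1norm v.
Proof.
have [iv|vi] := ltnP i (size v); last by rewrite nth_default // normr0 l1norm_ge0.
by rewrite /l1norm /coef_sum (bigD1 (Ordinal iv)) //= lerDl sumr_ge0.
Qed.

Lemma l1norm_take_drop m v :
  l1norm v = \sum_(j < m) `|v`_j| + l1norm (drop_poly m v).
Proof.
rewrite /l1norm (@coef_sumE _ (m + size v)) ?normr0 ?leq_addl // big_split_ord /=.
congr (_ + _); rewrite (@coef_sumE _ (size v)) ?normr0 ?size_drop_poly ?leq_subr//.
by apply: eq_bigr => i _; rewrite coef_drop_poly addnC.
Qed.

Lemma sum_sqr_le (n : nat) (F : nat -> R) : (forall i, 0 <= F i) ->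
  \sum_(i < n) F i ^+ 2 <= (\sum_(i < n) F i) ^+ 2.
Proof.
move=> F0; elim: n => [|n IH]; first by rewrite !big_ord0 expr0n.
rewrite !big_ord_recr /= sqrrD -addrA lerD // lerDr mulrn_wge0 //.
by rewrite mulr_ge0 // sumr_ge0.
Qed.

Definition lhalf_tail S v := lhalf (drop_poly S v).

Lemma lhalf_tailE S m v : (size v <= S + m)%N ->
  lhalf_tail S v = \sum_(s < m) Num.sqrt `|v`_(S + s)|.
Proof.
move=> vm; rewrite /lhalf_tail /lhalf (@coef_sumE _ m) ?sqrtN0 //.
  by apply: eq_bigr => i _; rewrite coef_drop_poly addnC.
by rewrite size_drop_poly leq_subLR.
Qed.

Lemma lhalf_tail_le S v : lhalf_tail S v <= lhalf v.
Proof.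
rewrite (@lhalf_tailE _ (size v)) ?leq_addl //.
rewrite /lhalf (@coef_sumE _ (S + size v)) ?sqrtN0 ?leq_addl // big_split_ord /=.
by rewrite lerDr sumr_ge0 // => i _; exact: sqrtr_ge0.
Qed.

Lemma sqrt_parallelogram (a b : R) :
  Num.sqrt `|b| <= Num.sqrt `|a + b| + Num.sqrt `|a - b|.
Proof.
apply: sqrt_le_sum => //.
have : `|b + b| <= `|a + b| + `|a - b|.
  by rewrite [X in `|X|](_ : _ = (a + b) - (a - b)) ?ler_normB //; ring.
by rewrite -mulr2n normrMn mulr2n; have := normr_ge0 b; lra.
Qed.

(** Beyond S', where v vanishes, both signs keep the mass of w; between S and S'
    the sum over the two signs sees at least the mass of v, whatever w is.  So
    one of w + v and w - v has mass at least that of w beyond S' plus half that of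
    v beyond S. *)
Lemma lhalf_tail_signs S S' v w : (S <= S')%N -> (size v <= S')%N ->
  lhalf_tail S' w *+ 2 + lhalf_tail S v <=
  lhalf_tail S (w + v) + lhalf_tail S (w - v).
Proof.
move=> SS' vS'.
pose n := (S' - S)%N; pose m := size w.
have SE : (S' + m = S + (n + m))%N by rewrite addnA subnKC.
have wm : (size w <= S + (n + m))%N by rewrite -SE leq_addl.
have vm : (size v <= S + (n + m))%N by rewrite -SE (leq_trans vS') // leq_addr.
rewrite (@lhalf_tailE S' m) ?leq_addl // !(@lhalf_tailE S (n + m)) //.
- rewrite -!big_split /= !big_split_ord /=.
  rewrite addrCA lerD //.
    by apply: ler_sum => i _; rewrite coefD coefB sqrt_parallelogram.
  rewrite (_ : \sum_(i < m) Num.sqrt `|v`_(S + (n + i))| = 0); last first.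
    apply: big1 => i _; rewrite nth_default ?sqrtN0 //.
    by rewrite (leq_trans vS') // addnA subnKC // leq_addr.
  rewrite addr0 -sumrMnl; apply: ler_sum => i _.
  rewrite coefD coefB (_ : v`_(S + (n + i)) = 0) ?subr0 ?addr0 ?addnA ?subnKC //.
  by rewrite nth_default // (leq_trans vS') // leq_addr.
- by rewrite (leq_trans (size_polyD _ _)) // geq_max wm size_polyN.
- by rewrite (leq_trans (size_polyD _ _)) // geq_max wm.
Qed.

End CoefSum.

(** * A quotient map from l^{1/2} onto l^1 *)

Section Synthesis.
Variable R : realType.
Implicit Types v w x : {poly R}.

(** A dense sequence in the unit sphere of l^1: the normalised rational vectors
    (and 0, from the index of the zero polynomial and from unused indices). *)
Definition atom (s : nat) : {poly R} :=
  let x := map_poly ratr (odflt 0 (unpickle s : option {poly rat})) in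
  (l1norm x)^-1 *: x.

Lemma l1norm_atom s : l1norm (atom s) <= 1.
Proof.
rewrite /atom; set x := map_poly _ _; rewrite l1normZ ger0_norm ?invr_ge0 ?l1norm_ge0 //.
have [->|x0] := eqVneq (l1norm x) 0; first by rewrite mulr0.
by rewrite mulVf.
Qed.

Lemma atom_rat (r : {poly rat}) :
  l1norm (map_poly ratr r : {poly R}) *: atom (pickle r) = map_poly ratr r.
Proof.
rewrite /atom pickleK /=; set x := map_poly _ _; rewrite scalerA.
have [x0|x0] := eqVneq (l1norm x) 0; first by rewrite x0 mul0r scale0r (l1norm0P x0).
by rewrite mulfV // scale1r.
Qed.

Definition atomX n := pickle ('X^n : {poly rat}).

Lemma atomXE n : atom (atomX n) = 'X^n.
Proof. by have := atom_rat 'X^n; rewrite map_polyXn l1normXn scale1r. Qed.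

Definition synth v : {poly R} := \sum_(s < size v) v`_s *: atom s.

Lemma synthE m v : (size v <= m)%N -> synth v = \sum_(s < m) v`_s *: atom s.
Proof.
move=> vm; rewrite /synth (big_ord_widen m (fun s => v`_s *: atom s)) // big_mkcond.
by apply: eq_bigr => i _; case: ltnP => // /leq_sizeP ->; rewrite ?scale0r.
Qed.

Lemma synth_is_linear : linear synth.
Proof.
move=> a v w; pose m := maxn (size v) (size w).
rewrite !(@synthE m) ?leq_maxl ?leq_maxr //; last first.
  rewrite (leq_trans (size_polyD _ _)) // geq_max leq_maxr andbT.
  by rewrite (leq_trans (size_scale_leq _ _)) // leq_maxl.
rewrite scaler_sumr -big_split /=; apply: eq_bigr => i _.
by rewrite coefD coefZ scalerDl scalerA.
Qed.
HB.instance Definition _ :=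
  GRing.isLinear.Build R {poly R} {poly R} _ synth synth_is_linear.

Lemma synthXn s : synth 'X^s = atom s.
Proof.
rewrite /synth size_polyXn big_ord_recr /= big1 ?add0r.
  by rewrite coefXn eqxx scale1r.
by move=> i _; rewrite coefXn (ltn_eqF (ltn_ord i)) scale0r.
Qed.

Lemma rat_approx x (e : R) : 0 < e ->
  exists r : {poly rat}, (size r <= size x)%N /\
    forall i, `|(x - map_poly ratr r)`_i| <= e.
Proof.
move=> e0.
have /choice[f fP] : forall i : nat, exists q : rat, `|x`_i - ratr q| <= e.
  move=> i; have [|q] := @rat_in_itvoo R (x`_i - e) (x`_i + e); first lra.
  by rewrite in_itv /= => /andP[h1 h2]; exists q; rewrite ler_norml; apply/andP; split; lra.
exists (\poly_(i < size x) f i); split; first exact: size_poly.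
move=> i; rewrite coefB coef_map /= coef_poly; case: ltnP => // /leq_sizeP xi.
by rewrite xi // rmorph0 subr0 normr0 ltW.
Qed.

(** A nearby rational vector y is a multiple of a single atom, so it has a lift
    with lhalf equal to the square root of its l^1 norm.  The difference x - y has
    at most size x coordinates; lifting it coordinate by coordinate is costly,
    but y can be chosen so close to x that the cost is negligible. *)
Lemma synth_lift x : exists v, synth v = x /\ lhalf v <= 2 * Num.sqrt (l1norm x).
Proof.
have [x0|xn0] := eqVneq (l1norm x) 0.
  by exists 0; rewrite linear0 lhalf0 (l1norm0P x0) mulr_ge0 ?sqrtr_ge0.
have a0 : 0 < l1norm x by rewrite lt_def xn0 l1norm_ge0.
set a := l1norm x in xn0 a0 *; pose M := size x.
(* The error e per coordinate makes |x - y|_1 <= a / n^2, so that each of the M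
   coordinates of x - y costs at most sqrt a / n, and y itself at most
   sqrt a + sqrt a / n. *)
pose n : R := M%:R + 1.
have n0 : 0 < n by rewrite ltr_wpDl.
pose e := a / n ^+ 3.
have e0 : 0 < e by rewrite divr_gt0 // exprn_gt0.
have [r [rM rE]] := rat_approx x e0.
pose y : {poly R} := map_poly ratr r; pose z := x - y.
have zM : (size z <= M)%N.
  rewrite (leq_trans (size_polyD _ _)) // geq_max leqnn size_polyN /=.
  by rewrite (leq_trans (size_poly _ _)).
have yE : l1norm y <= a + l1norm z.
  rewrite (_ : y = x - z); last by rewrite /z opprB addrC subrK.
  by rewrite (le_trans (ler_l1normD _ _)) // -scaleN1r l1normZ normrN1 mul1r.
have zE : l1norm z <= a / n ^+ 2.
  rewrite /l1norm (@coef_sumE _ _ M) ?normr0 //.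
  apply: le_trans (_ : \sum_(i < M) e <= _); first by apply: ler_sum => i _; exact: rE.
  rewrite sumr_const card_ord -mulr_natl.
  have -> : e = a / n ^+ 2 / n by rewrite /e exprSr invfM mulrA.
  rewrite mulrCA ler_piMr //; first by rewrite divr_ge0 ?exprn_ge0 ?(ltW n0) ?(ltW a0).
  by rewrite ler_pdivrMr // /n; lra.
exists (l1norm y *: 'X^(pickle r) + \sum_(j < M) z`_j *: 'X^(atomX j)); split.
  rewrite linearD linearZ /= synthXn atom_rat linear_sum /=.
  under eq_bigr do rewrite linearZ /= synthXn atomXE.
  rewrite -[RHS](subrK y) addrC; congr (_ + _); rewrite -/z -[RHS]coefK poly_def.
  rewrite [RHS](big_ord_widen M (fun i => z`_i *: 'X^i)) // [RHS]big_mkcond.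
  by apply: eq_bigr => i _; case: ltnP => // /leq_sizeP ->; rewrite ?scale0r.
apply: le_trans (ler_lhalfD _ _) _; rewrite lhalfZXn ger0_norm ?l1norm_ge0 //.
have h1 : Num.sqrt (l1norm y) <= Num.sqrt a + Num.sqrt a / n.
  have -> : Num.sqrt a / n = Num.sqrt (a / n ^+ 2).
    by rewrite sqrtrM ?ltW // -exprVn sqrtr_sqr ger0_norm // invr_ge0 ltW.
  apply: sqrt_le_sum; rewrite ?divr_ge0 ?exprn_ge0 ?(ltW n0) ?(ltW a0) //.
  by rewrite (le_trans yE) // lerD2l.
have h2 : lhalf (\sum_(j < M) z`_j *: 'X^(atomX j)) <= M%:R * (Num.sqrt a / n).
  apply: le_trans (lhalf_sum _ _) _.
  apply: le_trans (_ : \sum_(i < M) (Num.sqrt a / n) <= _); last first.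
    by rewrite sumr_const card_ord mulr_natl.
  apply: ler_sum => i _; rewrite lhalfZXn.
  have -> : Num.sqrt a / n = Num.sqrt (a / n ^+ 2).
    by rewrite sqrtrM ?ltW // -exprVn sqrtr_sqr ger0_norm // invr_ge0 ltW.
  rewrite ler_wsqrtr // (le_trans _ zE) //; exact: l1norm_coef.
apply: le_trans (lerD h1 h2) _.
have : (M%:R + 1) * (Num.sqrt a / n) = Num.sqrt a.
  by rewrite -/n mulrCA mulfV ?gt_eqF // mulr1.
by move: (Num.sqrt a / n) => t; lra.
Qed.

Lemma atoms_bounded S : exists m, forall s, (s < S)%N -> (size (atom s) <= m)%N.
Proof.
exists (\max_(s < S) size (atom s)) => s sS.
exact: (leq_bigmax (Ordinal sS)).
Qed.

(** The atoms of index less than S have no coordinate beyond m, so the part of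
    the image beyond m comes from the coefficients of index at least S. *)
Lemma drop_synth S m v : (forall s, (s < S)%N -> (size (atom s) <= m)%N) ->
  Num.sqrt (l1norm (drop_poly m (synth v))) <= lhalf_tail S v.
Proof.
move=> hm; rewrite (@synthE (S + size v)) ?leq_addl // big_split_ord /= linearD /=.
have -> : drop_poly m (\sum_(i < S) v`_i *: atom i) = 0.
  by rewrite linear_sum big1 //= => i _; rewrite linearZ /= drop_poly_eq0 ?scaler0 // hm.
rewrite add0r linear_sum /=.
rewrite -[leRHS]ger0_norm ?lhalf_ge0 // -sqrtr_sqr ler_wsqrtr //.
have : \sum_(i < size v) `|v`_(S + i)| <= lhalf_tail S v ^+ 2.
  rewrite (@lhalf_tailE _ _ (size v)) ?leq_addl //.
  have := @sum_sqr_le _ (size v) (fun i => Num.sqrt `|v`_(S + i)|) (fun=> sqrtr_ge0 _).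
  by apply: le_trans; apply: ler_sum => i _; rewrite sqr_sqrtr.
apply: le_trans; apply: le_trans (l1norm_sum _ _) _; apply: ler_sum => i _.
rewrite linearZ /= l1normZ ler_piMr //.
apply: le_trans (l1norm_atom (S + i)); rewrite (l1norm_take_drop m (atom _)).
by rewrite lerDr sumr_ge0.
Qed.
End Synthesis.

(** * Periodic families of liftings *)

Definition has_period T k (g : nat -> T) := forall i, g (k + i)%N = g i.

Definition is_periodic T (g : nat -> T) := exists2 k, (0 < k)%N & has_period k g.

Lemma has_periodM T k m (g : nat -> T) : has_period k g -> has_period (m * k) g.
Proof.
move=> gk; elim: m => [//|m IH] i.
by rewrite mulSn -addnA gk IH.
Qed.

Lemma has_periodMr T k m (g : nat -> T) : has_period k g -> has_period (k * m) g.
Proof. by rewrite mulnC; exact: has_periodM. Qed.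

Section Mean.
Variable R : realType.
Implicit Type g h : nat -> R.

(** Independent of the period that is picked ([meanE]). *)
Definition mean g : R :=
  let k := xget 1%N [set k | (0 < k)%N /\ has_period k g] in
  (\sum_(i < k) g i) / k%:R.

Lemma sum_periodic g k m : has_period k g ->
  \sum_(i < m * k) g i = m%:R * \sum_(i < k) g i.
Proof.
move=> gk; elim: m => [|m IH]; first by rewrite mul0n big_ord0 mul0r.
rewrite mulSn big_split_ord /= -natr1 mulrDl mul1r addrC -IH; congr (_ + _).
by apply: eq_bigr => i _; rewrite gk.
Qed.

Lemma meanE k g : (0 < k)%N -> has_period k g -> mean g = (\sum_(i < k) g i) / k%:R.
Proof.
move=> k0 gk; rewrite /mean; case: xgetP => [m _ [m0 gm]|/(_ k)]; last by case.
apply/eqP; rewrite eqr_div ?pnatr_eq0 -?lt0n // ![_ * _%:R]mulrC.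
by rewrite -sum_periodic // mulnC sum_periodic.
Qed.

Lemma meanD g h : is_periodic g -> is_periodic h ->
  mean (fun i => g i + h i) = mean g + mean h.
Proof.
move=> [k k0 gk] [m m0 hm].
have km0 : (0 < k * m)%N by rewrite muln_gt0 k0.
have gkm := has_periodMr m gk; have hkm := has_periodM k hm.
rewrite (meanE km0 gkm) (meanE km0 hkm) (@meanE (k * m)) // => [|i]; last first.
  by rewrite gkm hkm.
by rewrite big_split mulrDl.
Qed.

Lemma meanZ a g : is_periodic g -> mean (fun i => a * g i) = a * mean g.
Proof.
move=> [k k0 gk]; rewrite (meanE k0 gk) (@meanE k) // => [|i]; last by rewrite gk.
by rewrite -mulr_sumr mulrA.
Qed.

Lemma mean_cst a : mean (fun=> a) = a.
Proof. by rewrite (@meanE 1) // big_ord1 divr1. Qed.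

Lemma ler_mean g h : is_periodic g -> is_periodic h ->
  (forall i, g i <= h i) -> mean g <= mean h.
Proof.
move=> [k k0 gk] [m m0 hm] gh.
have km0 : (0 < k * m)%N by rewrite muln_gt0 k0.
rewrite (meanE km0 (has_periodMr m gk)) (meanE km0 (has_periodM k hm)).
by rewrite ler_wpM2r ?invr_ge0 //; apply: ler_sum.
Qed.

End Mean.

Section Space.
Variable R : realType.

(** Periodic sequences play the role of simple functions on a non-atomic
    probability space: a sequence of period k also has period 2 k, which leaves
    room to halve its mass. *)
Definition periodic_lift (f : nat -> {poly R}) : bool :=
  `[< is_periodic f /\ forall i, synth (f i) = synth (f 0%N) >].

Lemma periodic_lift_submod_closed : submod_closed periodic_lift.
Proof.
split=> [|a f g /asboolP[[k k0 fk] qf] /asboolP[[m m0 gm] qg]]; apply/asboolP; split.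
- by exists 1%N.
- by [].
- exists (k * m)%N; first by rewrite muln_gt0 k0.
  move=> i; rewrite /= !fctE.
  by rewrite (has_periodMr _ fk) (has_periodM _ gm).
- by move=> i; rewrite !fctE !linearP /= qf qg.
Qed.

HB.instance Definition _ := GRing.isSubmodClosed.Build R (nat -> {poly R})
  periodic_lift periodic_lift_submod_closed.

Record lifting := Lifting { lift_fun :> nat -> {poly R}; _ : periodic_lift lift_fun }.
HB.instance Definition _ := [isSub for lift_fun].
HB.instance Definition _ := [Choice of lifting by <:].
HB.instance Definition _ := [SubChoice_isSubLmodule of lifting by <:].

Implicit Types f g l : lifting.

Lemma lifting_period f : is_periodic f.
Proof. by have /asboolP[] := valP f. Qed.

Lemma synth_lifting f i : synth (f i) = synth (f 0%N).
Proof. by have /asboolP[_] := valP f. Qed.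

Lemma periodic_comp T (F : {poly R} -> T) f :
  is_periodic (fun i => F (f i)).
Proof. by have [k k0 fk] := lifting_period f; exists k => // i; rewrite fk. Qed.

Lemma lifting_eqP f g : (forall i, f i = g i) -> f = g.
Proof. by move=> fg; apply: val_inj; apply/funext. Qed.

Definition base f : {poly R} := synth (f 0%N).

Lemma base_is_linear : linear base.
Proof. by move=> a f g; rewrite /base /= !fctE linearP. Qed.
HB.instance Definition _ :=
  GRing.isLinear.Build R lifting {poly R} _ base base_is_linear.

Definition tail S f := mean (fun i => lhalf_tail S (f i)).
Definition fnorm f := mean (fun i => lhalf (f i)).

Lemma fnorm_ge0 f : 0 <= fnorm f.
Proof.
rewrite -[leLHS](mean_cst (0 : R)); apply: ler_mean; first by exists 1%N.
  exact: periodic_comp.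
by move=> i; exact: lhalf_ge0.
Qed.

Lemma ler_fnormD f g : fnorm (f + g) <= fnorm f + fnorm g.
Proof.
rewrite -meanD; try exact: periodic_comp.
apply: ler_mean => [||i]; first exact: periodic_comp.
  have [k k0 fk] := periodic_comp (@lhalf R) f.
  have [m m0 gm] := periodic_comp (@lhalf R) g.
  exists (k * m)%N => [|i]; first by rewrite muln_gt0 k0.
  by rewrite (has_periodMr _ fk) (has_periodM _ gm).
exact: ler_lhalfD.
Qed.

Lemma fnormZ a f : fnorm (a *: f) = Num.sqrt `|a| * fnorm f.
Proof.
rewrite -meanZ; last exact: periodic_comp.
by congr mean; apply/funext => i; rewrite -lhalfZ.
Qed.

Lemma tail_le_fnorm S f : tail S f <= fnorm f.
Proof.
apply: ler_mean => [||i]; try exact: periodic_comp.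
exact: lhalf_tail_le.
Qed.

Lemma lifting_bounded f S : exists2 S', (S <= S')%N & forall i, (size (f i) <= S')%N.
Proof.
have [k k0 fk] := lifting_period f.
exists (maxn S (\max_(i < k) size (f i))); first exact: leq_maxl.
move=> i; rewrite leq_max; apply/orP; right.
rewrite (divn_eq i k) (has_periodM _ fk).
exact: (leq_bigmax (Ordinal (ltn_pmod i k0))).
Qed.

Lemma tail_signs S S' f g : (S <= S')%N -> (forall i, size (f i) <= S')%N ->
  tail S' g *+ 2 + tail S f <= tail S (g + f) + tail S (g - f).
Proof.
move=> SS' fS'; have [k k0 fk] := lifting_period f; have [m m0 gm] := lifting_period g.
have km0 : (0 < k * m)%N by rewrite muln_gt0 k0.
have fkm := has_periodMr m fk; have gkm := has_periodM k gm.
have E (F : nat -> {poly R}) S0 : has_period (k * m) F ->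
    mean (fun i => lhalf_tail S0 (F i)) =
    (\sum_(i < k * m) lhalf_tail S0 (F i)) / (k * m)%:R.
  by move=> FP; apply: meanE => // i; rewrite FP.
rewrite /tail !E //; try by move=> i; rewrite /= !fctE fkm gkm.
rewrite -mulrnAl -!mulrDl ler_wpM2r ?invr_ge0 // -sumrMnl -!big_split.
by apply: ler_sum => i _; exact: lhalf_tail_signs.
Qed.

Lemma drop_base S m f : (forall s, (s < S)%N -> (size (@atom R s) <= m)%N) ->
  Num.sqrt (l1norm (drop_poly m (base f))) <= tail S f.
Proof.
move=> hm; rewrite -[leLHS]mean_cst; apply: ler_mean; first by exists 1%N.
  exact: periodic_comp.
by move=> i; rewrite /base -(synth_lifting f i); exact: drop_synth.
Qed.

Lemma base_lift x : exists2 b : lifting, base b = x & fnorm b <= 2 * Num.sqrt (l1norm x).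
Proof.
have [v [vx vn]] := synth_lift x.
have P : periodic_lift (fun=> v) by apply/asboolP; split => //; exists 1%N.
exists (Lifting P); first exact: vx.
by rewrite /fnorm /= mean_cst.
Qed.

(** f has period k, so masking it on alternate blocks of length k keeps exactly
    half of its mass, and the factor 2 multiplies lhalf by sqrt 2. *)
Lemma fnorm_mask k f (b : bool) (P : periodic_lift
    (fun i => if odd (i %/ k) == b then 2 *: f i else 0)) :
  (0 < k)%N -> has_period k f -> fnorm (Lifting P) = Num.sqrt 2 / 2 * fnorm f.
Proof.
move=> k0 fk; rewrite /fnorm [X in _ = _ * X](@meanE _ k) //; last first.
  by move=> i; rewrite fk.
rewrite (@meanE _ (k + k)) ?addn_gt0 ?k0 //; last first.
  by move=> i /=; rewrite addnn -mul2n divnMDl // oddD /= mul2n -addnn -addnA !fk.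
have E0 (i : 'I_k) : lhalf (if odd (i %/ k) == b then 2 *: f i else 0) =
    if b then 0 else Num.sqrt 2 * lhalf (f i).
  by rewrite divn_small //=; case: b {P}; rewrite ?lhalf0 // lhalfZ normr_nat.
have E1 (i : 'I_k) : lhalf (if odd ((k + i) %/ k) == b then 2 *: f (k + i)%N else 0) =
    if b then Num.sqrt 2 * lhalf (f i) else 0.
  rewrite divnDl // divnn k0 divn_small //= fk.
  by case: b {P E0}; rewrite ?lhalf0 // lhalfZ normr_nat.
rewrite big_split_ord /= (eq_bigr _ (fun i _ => E0 i)) (eq_bigr _ (fun i _ => E1 i)).
have -> : (\sum_(i < k) (if b then 0 else Num.sqrt 2 * lhalf (f i)) +
   \sum_(i < k) (if b then Num.sqrt 2 * lhalf (f i) else 0)) =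
   Num.sqrt 2 * \sum_(i < k) lhalf (f i).
  by case: b {P E0 E1}; rewrite big1_eq ?add0r ?addr0 mulr_sumr.
rewrite natrD; have : (k%:R : R) != 0 by rewrite pnatr_eq0 -lt0n.
move: (k%:R : R) (Num.sqrt 2) => t u t0.
by field; rewrite t0 /= -mulr2n mulrn_eq0.
Qed.

(** The masked families have base 0 only because l has: masking would destroy the
    constancy of any other base.  The norms of the halves are smaller than that
    of l by the factor 1 / sqrt 2, their squares by the factor 1 / 2. *)
Lemma kernel_split l : base l = 0 -> exists l1 l2 : lifting,
  [/\ base l1 = 0, base l2 = 0, l = 2^-1 *: (l1 + l2),
      fnorm l1 = Num.sqrt 2 / 2 * fnorm l & fnorm l2 = Num.sqrt 2 / 2 * fnorm l].
Proof.
move=> l0; have [k k0 lk] := lifting_period l.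
have sl i : synth (l i) = 0 by rewrite synth_lifting.
have P b : periodic_lift (fun i => if odd (i %/ k) == b then 2 *: l i else 0).
  apply/asboolP; split.
    exists (k + k)%N; first by rewrite addn_gt0 k0.
    by move=> i /=; rewrite addnn -mul2n divnMDl // oddD /= mul2n -addnn -addnA !lk.
  by move=> i; do 2!case: ifP => _; rewrite ?linearZ /= ?sl ?linear0 ?scaler0.
exists (Lifting (P false)), (Lifting (P true)); split.
- by rewrite /base /= div0n /= linearZ /= sl scaler0.
- by rewrite /base /= div0n /= linear0.
- apply: lifting_eqP => i; rewrite /= !fctE /=.
  by case: odd; rewrite /= ?add0r ?addr0 scalerA mulVf ?scale1r ?pnatr_eq0.
- exact: fnorm_mask.
- exact: fnorm_mask.
Qed.

End Space.

(** By [kernel_split] any bound C on the kernel improves to C / 2. *)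
Lemma functional_kernel (R : realType) (g : {linear lifting R -> R^o}) C :
  (forall f, `|g f| <= C * fnorm f ^+ 2) -> forall l, base l = 0 -> g l = 0.
Proof.
move=> gC.
have half n : forall l, base l = 0 -> 2 ^+ n * `|g l| <= C * fnorm l ^+ 2.
  elim: n => [|n IH] l l0; first by rewrite expr0 mul1r.
  have [l1 [l2 [b1 b2 lE n1 n2]]] := kernel_split l0.
  have := IH _ b1; have := IH _ b2; rewrite n1 n2.
  move: (fnorm l) => F; rewrite !exprMn !sqr_sqrtr //.
  have : `|g l| <= 2^-1 * (`|g l1| + `|g l2|).
    by rewrite lE linearZ /= normrM ger0_norm ?invr_ge0 // ler_wpM2l ?invr_ge0 // linearD ler_normD.
  have p0 : 0 < 2 ^+ n :> R by rewrite exprn_gt0.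
  rewrite -(ler_pM2l p0) [2 ^+ n.+1]exprS => h h1 h2.
  have E : C * (2 * 2^-1 ^+ 2 * F ^+ 2) = 2^-1 * (C * F ^+ 2) by field.
  rewrite E in h1 h2; lra.
move=> l l0; apply/eqP; rewrite -normr_eq0 eq_le normr_ge0 andbT leNgt; apply/negP => gl.
set K := C * fnorm l ^+ 2; pose n := (Num.trunc (K / `|g l|)).+1.
have := half n l l0; rewrite -ler_pdivlMr // leNgt => /negP; apply.
apply: lt_le_trans (truncnS_gt _) _; rewrite -natrX ler_nat.
by rewrite ltnW // ltn_expl.
Qed.

(** * Large kernel elements in small neighbourhoods *)

Section Core.
Variable R : realType.
Local Notation E := (lifting R).

Definition coord i (f : E) : R^o := (base f)`_i.
Lemma coord_is_linear i : linear (coord i).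
Proof. by move=> a f g; rewrite /coord linearP /= coefD coefZ. Qed.
HB.instance Definition _ i :=
  GRing.isLinear.Build R E R^o _ (coord i) (@coord_is_linear i).

Lemma tail_ge0 S (f : E) : 0 <= tail S f.
Proof.
rewrite -[leLHS](mean_cst (0 : R)); apply: ler_mean; first by exists 1%N.
  exact: periodic_comp.
by move=> i; exact: lhalf_ge0.
Qed.

Variable B : set_system E.
Hypothesis zb : zero_base B.
Hypothesis trivial_dual : forall (psi : {linear E -> R^o}) U A, B U ->
  (forall x, U x -> `|psi x| <= A) -> forall x, psi x = 0.

(** If all y in U with base in the unit ball had less than 3/4 of mass beyond m,
    then by homogeneity the base of every y in U would be bounded by 1 plus a
    multiple of its first m coordinates.  In particular the coordinate m would be,
    against [common_kernel]. *)
Lemma escaping m U : B U -> exists y, [/\ U y, l1norm (base y) <= 1 &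
  3 / 4 <= l1norm (drop_poly m (base y))].
Proof.
move=> BU; apply: contrapT => nE.
have bound y : U y -> `|coord m y| <= 1 + 4 * \sum_(i < m) `|coord i y|.
  move=> Uy; set s := \sum_(i < m) _; have s0 : 0 <= s by exact: sumr_ge0.
  have cy : `|coord m y| <= l1norm (base y) by exact: l1norm_coef.
  apply: le_trans cy _; have [y1|y1] := leP (l1norm (base y)) 1.
    by apply: le_trans y1 _; rewrite lerDl mulr_ge0.
  set a := l1norm (base y) in y1 *; have a0 : 0 < a by apply: lt_trans y1.
  have h : l1norm (drop_poly m (base y)) < 3 / 4 * a.
    rewrite ltNge; apply/negP => h; apply: nE; exists (a^-1 *: y); split.
    - by apply: (zb_balanced zb) => //; rewrite normfV gtr0_norm // invf_le1 // ltW.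
    - by rewrite linearZ /= l1normZ normfV gtr0_norm // -/a mulVf // gt_eqF.
    - rewrite linearZ /= linearZ /= l1normZ normfV gtr0_norm //.
      by rewrite ler_pdivlMl // mulrC.
  have : a = s + l1norm (drop_poly m (base y)) by exact: l1norm_take_drop.
  lra.
have [b bX _] := base_lift ('X^m : {poly R}).
have : coord m b = 0.
  apply: (common_kernel zb trivial_dual BU (ler0n _ 4) bound) => i im.
  by rewrite /= /coord bX coefXn (ltn_eqF im).
by rewrite /coord bX coefXn eqxx => /eqP; rewrite oner_eq0.
Qed.

(** By induction: first y is taken with mass beyond S, then z for an S' beyond
    which y vanishes, and the sign comes from [tail_signs]. *)
Lemma growth k U S : B U -> exists z,
  [/\ U z, l1norm (base z) <= k%:R & k%:R / 4 <= tail S z].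
Proof.
elim: k U S => [|k IH] U S BU.
  exists 0; split; first exact: (zb_zero zb).
  - by rewrite linear0 l1norm0.
  - by rewrite mul0r tail_ge0.
have [V BV VU] := zb_add zb BU.
have [m mS] := atoms_bounded R S.
have [y [Vy y1 ym]] := escaping m BV.
have [S' SS' yS'] := lifting_bounded y S.
have [z [Vz zk zS']] := IH V S' BV.
have ty : 1 / 2 <= tail S y.
  apply: le_trans (drop_base y mS).
  have h0 : 0 <= 1 / 2 :> R by rewrite divr_ge0.
  by rewrite -[leLHS](ger0_norm h0) -sqrtr_sqr ler_wsqrtr //; lra.
have sg := tail_signs z SS' yS'.
have VNy : V (- y).
  by rewrite -scaleN1r; apply: (zb_balanced zb) => //; rewrite normrN1.
have kS : k.+1%:R = k%:R + 1 :> R by rewrite natr1.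
have [h|h] := leP (k.+1%:R / 4) (tail S (z + y)).
  exists (z + y); split; rewrite ?linearD //; first exact: VU.
  by rewrite kS (le_trans (ler_l1normD _ _)) // lerD.
exists (z - y); split; first exact: VU.
  rewrite linearB /= kS (le_trans (ler_l1normD _ _)) // lerD //.
  by rewrite -scaleN1r l1normZ normrN1 mul1r.
by rewrite kS in h *; rewrite mulr2n in sg; lra.
Qed.

Hypothesis B_fnorm : forall U, B U -> exists2 r, 0 < r & forall x, fnorm x < r -> U x.

(** Scaling a vector from [growth] down by k^2 makes its base tend to 0 like 1/k
    while its norm is at least 1/4; removing a lift of that small base leaves an
    element of the kernel without leaving the neighbourhood. *)
Lemma large_kernel_element U : B U ->
  exists l, [/\ base l = 0, U l & 1 / 8 <= fnorm l].
Proof.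
move=> BU.
have [V BV VU] := zb_sub zb BU.
have [r r0 rV] := B_fnorm BV.
pose d := Num.min r (1 / 8); have d0 : 0 < d by rewrite lt_min r0 divr_gt0.
have [n nd] : exists n : nat, 2 / d < n.+1%:R.
  by exists (Num.trunc (2 / d)); rewrite truncnS_gt.
set a : R := n.+1%:R in nd; have a0 : 0 < a by rewrite ltr0n.
have ad : 2 / a < d by rewrite ltr_pdivrMr // mulrC -ltr_pdivrMr.
have [z [Vz zk zt]] := growth (n.+1 ^ 2) 0 BV.
have {zt} zt : a ^+ 2 / 4 <= fnorm z.
  by rewrite -natrX; apply: le_trans zt (tail_le_fnorm _ _).
rewrite natrX -/a in zk.
pose w := (a ^+ 4)^-1 *: z.
have a4 : 0 < a ^+ 4 by rewrite exprn_gt0.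
have Vw : V w.
  apply: (zb_balanced zb) => //; rewrite normfV gtr0_norm // invf_le1 //.
  by rewrite exprn_ege1 // ler1n.
have bw : l1norm (base w) <= (a^-1) ^+ 2.
  rewrite linearZ /= l1normZ normfV gtr0_norm // ler_pdivrMl //.
  by rewrite exprVn -[4%N]/(2 + 2)%N exprD mulfK // expf_neq0 // gt_eqF.
have fw : 1 / 4 <= fnorm w.
  rewrite fnormZ normfV gtr0_norm // (_ : (a ^+ 4)^-1 = ((a ^+ 2)^-1) ^+ 2).
    rewrite sqrtr_sqr gtr0_norm ?invr_gt0 ?exprn_gt0 //.
    by rewrite ler_pdivlMl ?exprn_gt0 // mul1r.
  by rewrite exprVn -exprM.
have [b bE bn] := base_lift (base w).
have {bn} bn : fnorm b <= 2 / a.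
  apply: le_trans bn _; rewrite ler_wpM2l //.
  have ai : 0 <= a^-1 by rewrite invr_ge0 ltW.
  by rewrite -[leRHS](ger0_norm ai) -sqrtr_sqr ler_wsqrtr.
have /andP[br b8] : (fnorm b < r) && (fnorm b < 1 / 8).
  by rewrite -lt_min -/d; apply: le_lt_trans ad.
exists (w - b); split.
- by rewrite linearB /= bE subrr.
- by apply: VU => //; exact: rV.
- have := ler_fnormD (w - b) b; rewrite subrK; lra.
Qed.

End Core.

(** * The example *)

Section Decomposition.
Variables (R : realType) (Y : quasiBanachType R).

Lemma qnorm0 : qnorm (0 : Y) = 0.
Proof. by rewrite -(scale0r 0) qnormZ normr0 mul0r. Qed.

Lemma qnorm_nbhs (tau : vector_topology Y) (U : set Y) :
  (forall O : set Y, opens tau O -> qnorm_open O) ->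
  nbhs (0 : endow_vt tau) U -> exists2 e, 0 < e & forall y, qnorm y < e -> U y.
Proof.
move=> finer; rewrite (@nbhsE (endow_vt tau)) => -[ O [ oO O0] OU].
have [e e0 eO] := finer O oO 0 O0.
by exists e => // y ye; apply/OU/eO; rewrite subr0.
Qed.

Lemma outside_zero_closure (tau : vector_topology Y) (y : Y) :
  nearly_convex (endow_vt tau) -> ~ zero_closure (y : endow_vt tau) ->
  exists g : {linear endow_vt tau -> R^o}, continuous g /\ g y <> 0.
Proof.
move=> nc yN; pose Q := hausdorff_quotient (endow_vt tau).
pose p (x : endow_vt tau) : Q := (\pi_Q x)%qT.
have pL : linear p.
  by move=> a x z; rewrite /p raddfD; congr (_ + _); exact: pi_hq_scale.
have yQ : p y <> p 0.
  move=> /eqP; rewrite -Quotient.idealrBE subr0; exact: yN.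
have [f [fc fy]] := nc _ _ yQ.
have fpL : linear (f \o p).
  by move=> a x z /=; rewrite pL linearP.
pose g : {linear endow_vt tau -> R^o} :=
  HB.pack (f \o p) (GRing.isLinear.Build R (endow_vt tau) R^o _ (f \o p) fpL).
exists g; split.
  apply/continuousP => O oO.
  by move/continuousP: fc => /(_ O oO).
have p0 : p 0 = 0 by rewrite /p raddf0.
by move=> gy; apply: fy; rewrite [f (p y)]gy p0 linear0.
Qed.

(** The class of a vector outside the closure of 0 is separated from 0 by a
    continuous functional on the Hausdorff quotient ([outside_zero_closure]). *)
Lemma nearly_convex_null (tau : vector_topology Y) (y : Y) (O : set Y) :
  nearly_convex (endow_vt tau) ->
  (forall g : {linear endow_vt tau -> R^o}, continuous g -> g y = 0) ->
  nbhs (0 : endow_vt tau) O -> O y.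
Proof.
move=> nc gy O0; have [yc|yc] := pselect (zero_closure (y : endow_vt tau)); last first.
  by have [g [gc]] := outside_zero_closure nc yc; rewrite gy.
have N0 : nbhs (0 : endow_vt tau) [set x : endow_vt tau | O (- x)].
  apply: filterS (nbhs0_scale (-1) O0) => x /=.
  by rewrite scaleN1r.
have /zero_closureP/(_ _ (@nbhs0_translate R (endow_vt tau) y _ N0)) := yc.
by rewrite /= sub0r opprK.
Qed.

End Decomposition.

Section Main.
Variable R : realType.
Local Notation E := (lifting R).

Definition half_lifting := HalfNormedType (@fnorm_ge0 R) (@ler_fnormD R) (@fnormZ R).

Section NoDecomposition.
Variables (Y : quasiBanachType R) (i : {linear E -> Y}).
Hypothesis i_qnorm : forall x, qnorm (i x) = fnorm x ^+ 2.
Hypothesis sqrt_qnormD : forall y z : Y,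
  Num.sqrt (qnorm (y + z)) <= Num.sqrt (qnorm y) + Num.sqrt (qnorm z).
Hypothesis i_dense : forall (y : Y) e, 0 < e -> exists x, qnorm (y - i x) < e.
Hypothesis i_extend : forall (g : {linear E -> R^o}) C, 0 <= C ->
  (forall x, `|g x| <= C * fnorm x ^+ 2) -> exists h : {linear Y -> R^o},
    (forall x, h (i x) = g x) /\ forall y, `|h y| <= C * qnorm y.
Variables tau1 tau2 : vector_topology Y.
Hypothesis nc1 : nearly_convex (endow_vt tau1).
Hypothesis td2 : has_trivial_dual (endow_vt tau2).
Hypothesis sup12 : is_supremum (qnorm_topology Y) tau1 tau2.

Let finer1 (O : set Y) : opens tau1 O -> qnorm_open O.
Proof. exact: (sup_finer sup12 (b := true)). Qed.
Let finer2 (O : set Y) : opens tau2 O -> qnorm_open O.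
Proof. exact: (sup_finer sup12 (b := false)). Qed.

Let base_null l (O : set Y) : base l = 0 -> nbhs (0 : endow_vt tau1) O -> O (i l).
Proof.
move=> l0; apply: nearly_convex_null => // g gc.
have [e e0 eg] := qnorm_nbhs finer1 (continuous_bounded gc).
pose gi x : R^o := g (i x).
have giL : linear gi by move=> a x y; rewrite /gi linearP [LHS](linearP g).
pose h : {linear half_lifting -> R^o} :=
  HB.pack gi (GRing.isLinear.Build R E R^o _ gi giL).
have hb := @bounded_near0 R half_lifting h 1 e e0.
apply: (functional_kernel (g := h) (C := 1 / e)) l0; apply: hb => x xe.
by apply/ltW/eg; rewrite i_qnorm.
Qed.

Let B := [set i @^-1` U | U in @balanced_nbhs R (endow_vt tau2)].

Let B_base : zero_base B.
Proof. exact: zero_base_preimage (balanced_nbhs_base _). Qed.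

Let B_qnorm (U : set Y) : nbhs (0 : endow_vt tau2) U ->
  exists2 e, 0 < e & forall y, qnorm y < e -> U y.
Proof. exact: qnorm_nbhs. Qed.

Let B_kernel : exists2 U, B U & forall l, base l = 0 -> U l -> fnorm l < 1 / 8.
Proof.
(* The square root of this quasi-norm is subadditive, so its balls are open. *)
pose D := [set y : Y | Num.sqrt (qnorm y) < 1 / 8].
have oD : opens (qnorm_topology Y) D.
  move=> x; rewrite /D /= => xD; exists ((1 / 8 - Num.sqrt (qnorm x)) ^+ 2).
    by rewrite exprn_gt0 // subr_gt0.
  move=> y yx; have := sqrt_qnormD (y - x) x; rewrite subrK => /le_lt_trans; apply.
  rewrite -ltrBrDr -[ltRHS]ger0_norm ?subr_ge0 ?ltW // -sqrtr_sqr.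
  by rewrite ltr_sqrt // exprn_gt0 // subr_gt0.
have D0 : D 0 by rewrite /D /= qnorm0 sqrtr0 divr_gt0.
have [ O1 [ O2 [[oO1 O10] [oO2 O20] O12]]] := sup_open sup12 oD D0.
have n1 : nbhs (0 : endow_vt tau1) O1 by exact: (@open_nbhs_nbhs (endow_vt tau1)).
have n2 : nbhs (0 : endow_vt tau2) O2 by exact: (@open_nbhs_nbhs (endow_vt tau2)).
have [V Vb VO] := nbhs0_balanced n2.
exists (i @^-1` V) => [|l l0 Vl]; first by exists V.
have := O12 (i l) (conj (base_null l0 n1) (VO _ Vl)).
by rewrite /D /= i_qnorm sqrtr_sqr ger0_norm // fnorm_ge0.
Qed.

Let B_fnorm U : B U -> exists2 r, 0 < r & forall x, fnorm x < r -> U x.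
Proof.
move=> [V [V0 _] <-]; have [e e0 eV] := B_qnorm V0.
exists (Num.sqrt e) => [|x xe]; first by rewrite sqrtr_gt0.
apply: eV; rewrite i_qnorm -[ltRHS]sqr_sqrtr ?ltW //.
by rewrite ltr_pXn2r ?nnegrE ?fnorm_ge0 ?sqrtr_ge0.
Qed.

(* A functional bounded on a member of B extends to Y, where density and one
   halving of the neighbourhood turn its bound into tau2-continuity. *)
Let B_trivial_dual (psi : {linear E -> R^o}) U A : B U ->
  (forall x, U x -> `|psi x| <= A) -> forall x, psi x = 0.
Proof.
move=> [V Vb <-] psiA; have [e e0 eV] := B_qnorm Vb.1.
have psiC := @bounded_near0 R half_lifting psi A e e0.
have {psiC} psiC x : `|psi x| <= A / e * fnorm x ^+ 2.
  by apply: psiC => z ze; apply: psiA; apply: eV; rewrite i_qnorm.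
have A0 : 0 <= A.
  by apply: le_trans (psiA 0 _) => //=; rewrite linear0; exact: nbhs_singleton Vb.1.
have C0 : 0 <= A / e by rewrite divr_ge0 // ltW.
have [h [hi hC]] := i_extend C0 psiC.
have hL : linear (h : endow_vt tau2 -> R^o) by move=> a x y; rewrite [LHS](linearP h).
pose k : {linear endow_vt tau2 -> R^o} :=
  HB.pack (h : endow_vt tau2 -> R^o) (GRing.isLinear.Build R (endow_vt tau2) R^o _ _ hL).
have kc : continuous k.
  have [W Wb WV] := zb_sub (balanced_nbhs_base (endow_vt tau2)) Vb.
  have [d d0 dW] := B_qnorm Wb.1.
  apply: (@bounded_continuous R (endow_vt tau2) k W (A + 1) Wb.1) => y Wy.
  pose c := A / e + 1; have c0 : 0 < c by rewrite ltr_wpDl.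
  have [|x] := i_dense y (e := Num.min d c^-1); first by rewrite lt_min d0 invr_gt0.
  rewrite lt_min => /andP[/dW Wyx yxc].
  have Vx : V (i x) by have := WV _ _ Wy Wyx; rewrite subKr.
  have -> : k y = psi x + h (y - i x) by rewrite linearB hi addrC subrK.
  apply: le_trans (ler_normD _ _) _; apply: lerD; first exact: psiA.
  apply: le_trans (hC _) _.
  have q0 : 0 <= qnorm (y - i x) by exact: qnorm_ge0.
  have : c * qnorm (y - i x) <= 1 by rewrite -ler_pdivlMl // mulr1 ltW.
  by apply: le_trans; rewrite ler_wpM2r // lerDl.
by move=> x; rewrite -hi; exact: (td2 kc).
Qed.

Lemma no_decomposition : False.
Proof.
have [U BU kU] := B_kernel.
have [l [l0 Ul]] := large_kernel_element B_base B_trivial_dual B_fnorm BU.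
by rewrite leNgt kU.
Qed.

End NoDecomposition.
End Main.

Theorem theorem1p4 (R : realType) :
  exists Y : quasiBanachType R,
    ~ exists tau1 tau2 : vector_topology Y,
        [/\ nearly_convex (endow_vt tau1),
            has_trivial_dual (endow_vt tau2)
          & is_supremum (qnorm_topology Y) tau1 tau2].
Proof.
have [Y [i [iN iD id ie]]] := half_normed_completion (half_lifting R).
exists Y => -[tau1 [tau2 [nc1 td2 sup12]]].
exact: (no_decomposition iN iD id ie nc1 td2 sup12).
Qed.
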